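(* Let $G$ and $H$ be finitely generated virtually Abelian groups. Let $G\stackrel{\alpha}{\curvearrowright}(X,\mu)$ and $H\stackrel{\beta}{\curvearrowright}(Y,\nu)$ be free probability-measure-preserving actions which are Shannon orbit equivalent. Then $h(\alpha)=h(\beta)$.
   Context: Probability spaces are standard, and p.m.p. means probability-measure-preserving. Partitions are measurable and are considered modulo null sets. A group is virtually Abelian if it has an Abelian subgroup of finite index (such groups are amenable; finite groups are allowed). Shannon orbit equivalence. Let $G\curvearrowright(X,\mu)$ and $H\curvearrowright(Y,\nu)$ be free p.m.p. actions of countable groups. An orbit equivalence between them is a measure isomorphism $\varphi$ from a $G$-invariant conull set $X_0\subseteq X$ to an $H$-invariant conull set $Y_0\subseteq Y$ such that $\varphi(Gx)=H\varphi(x)$ for all $x\in X_0$. Its associated cocycles $\kappa:G\times X\to H$ and $\lambda:H\times Y\to G$ are defined a.e. by $\kappa(g,x)\varphi(x)=\varphi(gx)$ and $\lambda(s,y)\varphi^{-1}(y)=\varphi^{-1}(sy)$ (a.e. unique by freeness). For $g\in G$ one has the countable partition $\{X_{g,s}:s\in H\}$ of $X$ with $X_{g,s}=\{x\in X:\kappa(g,x)=s\}$, and for $s\in H$ the countable partition $\{Y_{s,g}:g\in G\}$ of $Y$ with $Y_{s,g}=\{y\in Y:\lambda(s,y)=g\}$. The Shannon entropy of a countable partition $\mathcal{P}$ of a probability space $(X,\mu)$ is $H(\mathcal{P})=\sum_{A\in\mathcal{P}}-\mu(A)\log\mu(A)$. The cocycle $\kappa$ (respectively $\lambda$) is Shannon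 if for every $g\in G$ (respectively $s\in H$) the corresponding partition has finite Shannon entropy. If both $\kappa$ and $\lambda$ are Shannon then $\varphi$ is called a Shannon orbit equivalence, and the two actions are Shannon orbit equivalent if such a $\varphi$ exists. Entropy. Let $G\stackrel{\alpha}{\curvearrowright}(X,\mu)$ be a p.m.p. action of a countable amenable group. A Følner sequence for $G$ is a sequence $\{F_n\}$ of nonempty finite subsets of $G$ with $\lim_{n\to\infty}|gF_n\Delta F_n|/|F_n|=0$ for all $g\in G$. For a finite partition $\mathcal{P}$ of $X$ and a finite $F\subseteq G$ write $\mathcal{P}^F=\bigvee_{g\in F}g^{-1}\mathcal{P}$. Then $h(\alpha,\mathcal{P})=\lim_{n\to\infty}\frac{1}{|F_n|}H(\mathcal{P}^{F_n})$ (the limit exists and equals $\inf_F\frac{1}{|F|}H(\mathcal{P}^F)$ over nonempty finite $F\subseteq G$), and $h(\alpha)=\sup_{\mathcal{P}}h(\alpha,\mathcal{P})\in[0,\infty]$, the supremum being over all finite partitions of $X$. *)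

(* Defs.v *)
From HB Require Import structures.
From mathcomp Require Import all_boot all_order all_algebra finmap.
From mathcomp Require Import all_classical all_reals all_analysis.

Set Implicit Arguments.
Unset Strict Implicit.
Unset Printing Implicit Defensive.

Import Order.TTheory GRing.Theory Num.Theory.
Import numFieldNormedType.Exports.

Local Open Scope classical_set_scope.
Local Open Scope ring_scope.
Local Open Scope ereal_scope.

Section Groups.
Variable G : groupType.
Implicit Types S A : {pred G}.

Definition finitely_generated : Prop :=
  exists s : seq G,
    forall S, group_closed S -> {subset s <= S} -> forall g, g \in S.

(* Finite index: finitely many left cosets [t A] cover [G]. *)
Definition virtually_abelian : Prop :=
  exists A, [/\ group_closed A,
    {in A &, forall a b, commute a b} &
    exists s : seq G, forall g, exists2 t, t \in s & (t^-1 * g)%g \in A].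

Definition translate (g : G) (F : {fset G}) : {fset G} :=
  [fset (g * x)%g | x in F]%fset.

Definition fsym_diff (E F : {fset G}) : {fset G} :=
  ((E `\` F) `|` (F `\` E))%fset.

Definition folner_sequence (R : realType) (F : nat -> {fset G}) : Prop :=
  (forall n, F n != fset0) /\
  (forall g : G,
    (fun n => #|` fsym_diff (translate g (F n)) (F n)|%:R / #|` F n|%:R : R)%R
      @ \oo --> (0 : R)%R).

End Groups.

(* Standard Borel: isomorphic, as a measurable space, to a Polish space (a
   separable complete metric space) with its Borel sigma-algebra.  A
   pseudometric is a metric exactly when its topology is Hausdorff. *)
Definition standard_borel (R : realType) d (X : measurableType d) : Prop :=
  exists (P : completePseudoMetricType R) (f : X -> P),
    [/\ hausdorff_space P,
        exists2 D : set P, countable D & dense D,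
        bijective f &
        forall A : set P, <<s [set U : set P | open U] >> A
                            <-> measurable (f @^-1` A)].

Section Partitions.
Context (R : realType) d (X : measurableType d).
Variable mu : probability X R.

(* A partition is given as a family of cells; empty cells contribute nothing
   since [0 * ln 0 = 0]. *)
Definition shannon_entropy (I : choiceType) (P : I -> set X) : \bar R :=
  \esum_(i in [set: I]) (- (fine (mu (P i)) * ln (fine (mu (P i)))))%:E.

Definition is_partition (I : Type) (P : I -> set X) : Prop :=
  [/\ forall i, measurable (P i), trivIset [set: I] P &
      \bigcup_(i in [set: I]) P i = [set: X]].

End Partitions.

Section Actions.
Context (R : realType) d (X : measurableType d).
Variable mu : probability X R.
Variable G : groupType.
Variable act : G -> X -> X.

Record pmp_action : Prop := {
  pmp_act1 : forall x, act 1%g x = x;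
  pmp_actM : forall g h x, act (g * h)%g x = act g (act h x);
  pmp_measurable : forall g, measurable_fun [set: X] (act g);
  pmp_preserving : forall g A, measurable A -> mu (act g @^-1` A) = mu A
}.

Definition free_action : Prop :=
  {ae mu, forall x, forall g, act g x = x -> g = 1%g}.

Definition act_orbit (x : X) : set X := range (fun g => act g x).

(* The cells of the join of the [g^-1 P], [g] in [F], are indexed by the
   functions choosing one cell of [P] for each [g]. *)
Definition join_partition (F : {fset G}) k (P : 'I_k -> set X) :
    {ffun F -> 'I_k} -> set X :=
  fun w => \bigcap_(g in [set: F]) act (val g) @^-1` P (w g).

Definition average_entropy k (P : 'I_k -> set X) (F : {fset G}) : \bar R :=
  ((#|` F|%:R)^-1)%:E * shannon_entropy mu (@join_partition F k P).

(* The common limit of the averages along all Folner sequences. *)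
Definition entropy_partition k (P : 'I_k -> set X) : \bar R :=
  xget 0 [set h : \bar R | forall F : nat -> {fset G}, folner_sequence R F ->
    (fun n => average_entropy P (F n)) @ \oo --> h].

Definition action_entropy : \bar R :=
  ereal_sup [set h | exists k (P : 'I_k -> set X),
    is_partition P /\ h = entropy_partition P].

End Actions.

Section OrbitEquivalence.
Context (R : realType) d d' (X : measurableType d) (Y : measurableType d').
Variables (mu : probability X R) (nu : probability Y R).
Variables (G H : groupType) (alpha : G -> X -> X) (beta : H -> Y -> Y).

(* [phi] is the isomorphism [X0 -> Y0] and [psi] its inverse; their values off
   [X0] and [Y0] are irrelevant. *)
Record orbit_equivalence (X0 : set X) (Y0 : set Y)
    (phi : X -> Y) (psi : Y -> X) : Prop := {
  oe_dom_measurable : measurable X0;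
  oe_dom_conull : mu X0 = 1;
  oe_dom_invariant : forall g x, X0 x -> X0 (alpha g x);
  oe_cod_measurable : measurable Y0;
  oe_cod_conull : nu Y0 = 1;
  oe_cod_invariant : forall s y, Y0 y -> Y0 (beta s y);
  oe_bij : set_bij X0 Y0 phi;
  oe_inverse : {in X0, cancel phi psi};
  oe_measurable : measurable_fun X0 phi;
  oe_inverse_measurable : measurable_fun Y0 psi;
  oe_preserving : forall B, measurable B ->
    mu (X0 `&` phi @^-1` B) = nu (Y0 `&` B);
  oe_orbits : forall x, X0 x ->
    phi @` act_orbit alpha x = act_orbit beta (phi x)
}.

Definition cocycle_cell (kappa : G -> X -> H) (g : G) (s : H) : set X :=
  [set x | kappa g x = s].

(* The cocycle is only determined almost everywhere; a version with measurable
   cells is required. *)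
Definition is_cocycle (phi : X -> Y) (kappa : G -> X -> H) : Prop :=
  (forall g s, measurable (cocycle_cell kappa g s)) /\
  (forall g, {ae mu, forall x, beta (kappa g x) (phi x) = phi (alpha g x)}).

Definition shannon_cocycle (kappa : G -> X -> H) : Prop :=
  forall g, shannon_entropy mu (cocycle_cell kappa g) < +oo.

End OrbitEquivalence.

Definition shannon_orbit_equivalent (R : realType) d d'
    (X : measurableType d) (Y : measurableType d')
    (mu : probability X R) (nu : probability Y R) (G H : groupType)
    (alpha : G -> X -> X) (beta : H -> Y -> Y) : Prop :=
  exists (X0 : set X) (Y0 : set Y) (phi : X -> Y) (psi : Y -> X),
    orbit_equivalence mu nu alpha beta X0 Y0 phi psi /\
    exists (kappa : G -> X -> H) (lambda : H -> Y -> G),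
      [/\ is_cocycle mu alpha beta phi kappa,
          is_cocycle nu beta alpha psi lambda,
          shannon_cocycle mu kappa &
          shannon_cocycle nu lambda].

(* Main.v *)
Require Import Defs.
From mathcomp Require Import all_boot all_order all_algebra finmap.
From mathcomp Require Import all_classical all_reals all_analysis.
From mathcomp Require Import ring lra zify.

Set Implicit Arguments.
Unset Strict Implicit.
Unset Printing Implicit Defensive.

Import Order.TTheory GRing.Theory Num.Theory.
Import numFieldNormedType.Exports.

Local Open Scope classical_set_scope.
Local Open Scope ring_scope.

(** Let [kappa] be the cocycle of the orbit equivalence, so that
    [phi (g x) = kappa g x (phi x)]. By symmetry it suffices to show
    [h(alpha) <= h(beta)]. The idea is to encode a long [alpha]-name of a point
    by a [beta]-name over equally many points of the same orbit, at a cost of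
    few additional bits.

    Both entropies are infima: Shearer's inequality shows that the averages
    [H(P^F) / |F|] converge, along every Folner sequence, to their infimum over
    all nonempty finite [F] ([entropy_partitionE]). Hence it is enough to find,
    for a partition [P] and [e > 0], a partition [R] such that every nonempty
    finite subset [E] of [H] has a partner [A] in [G] with
    [H(P^A) / |A| <= H(R^E) / |E| + e], where the second join is taken along the
    action of [H] on the orbits ([main_estimate]).

    Virtual commutativity of [H] gives [cocycle_sublinear]: [kappa] at a product
    of [n] generators of [G] is a product of [n] random elements of [H], each
    distributed like one of finitely many variables of finite Shannon entropy.
    A product in an abelian group depends only on the multiplicities of its
    factors. Those of finitely many frequent values contribute [O(ln n)], and the
    rare values contribute [e n] because the tail of the entropy series is small.
    So the entropy of [kappa u] is [o(n)] for [u] of length [n].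

    Virtual commutativity of [G] gives polynomial growth, hence word balls that
    are Folner sets. Let [G] be infinite, [A] such a ball, and [V] a maximal
    subset of [A] for which the sets [B_r v], [v] in [V], are disjoint, so that
    [V] has at most about [|A| / |B_r|] points, and [|B_r| > r]. Since balls are
    connected, the points of [V] are reached from one another by steps of length
    [4 r + 1], so the positions [kappa v x], [v] in [V], have total entropy
    [|V| o(r) = o(|A|)] ([net_desc]). Take [R = P^(B_2r)]: its values at the
    points [v x] determine [P^A] at [x].

    Around every position [kappa v x] place a translate of a finite subset [L] of
    [H] that contains most values of [kappa] on [B_2r], and discard the few [v]
    for which [E L (kappa v x)] leaves [kappa A x]. The union [D] of the remaining
    translates is known from the positions and from one more bit for each [v], it
    fills almost all of [kappa A x], and [E D] is contained in [kappa A x], which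
    has [|A|] elements. Given [D], Shearer's inequality bounds the entropy of the
    [R]-name over [E D] by the sum over [h] in [D] of the entropies over [E h],
    divided by [|E|], up to a small error. Now [D] is random and correlated with
    the names. But the points [h x] with [h] in [D] are among the points [a x]
    with [a] in [A], whose law is invariant, so by concavity of entropy the sum is
    at most [|A| H(R^E)] ([sum_translates]). This gives [cell_inequality], and
    with a suitable choice of [r], [L] and [A] the required estimate.

    If [G] is finite, then so is [H], with at most as many elements, and one can
    take [A = G] and [R = P^G]. *)

(** * Word balls in finitely generated groups *)

Section Balls.
Variable G : groupType.
Variable gens : seq G.

(** The unit is a letter, so that the balls increase with the radius. *)
Definition letters : seq G := 1%g :: gens ++ [seq (g^-1)%g | g <- gens].

Fixpoint wball (n : nat) : {fset G} :=
  if n is m.+1 then [fset (s * x)%g | s in letters, x in wball m]%fset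
  else [fset 1%g]%fset.

Lemma letters1 : 1%g \in letters. Proof. exact: mem_head. Qed.

Lemma lettersV s : s \in letters -> (s^-1)%g \in letters.
Proof.
rewrite /letters !inE => /orP[/eqP->|]; first by rewrite invg1 eqxx.
rewrite !mem_cat => /orP[sg|/mapP[t tg ->]]; last by rewrite invgK tg orbT.
by rewrite (map_f _ sg) !orbT.
Qed.

Lemma wballS n s x : s \in letters -> x \in wball n -> (s * x)%g \in wball n.+1.
Proof. by move=> sl xb; apply/imfset2P; exists s => //; exists x. Qed.

Lemma wballSP n g : g \in wball n.+1 ->
  exists2 s, s \in letters & exists2 x, x \in wball n & g = (s * x)%g.
Proof. by move=> /imfset2P[s sl [x xb ->]]; exists s => //; exists x. Qed.

Lemma wball0 : wball 0 = [fset 1%g]%fset. Proof. by []. Qed.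

Lemma wball_leS n : {subset wball n <= wball n.+1}.
Proof. by move=> g gb; rewrite -[g]mul1g; apply: wballS => //; exact: letters1. Qed.

Lemma wball_le m n : (m <= n)%N -> {subset wball m <= wball n}.
Proof.
by move/subnK <-; elim: (n - m)%N => // k IH g /IH; exact: wball_leS.
Qed.

Lemma wball1 n : 1%g \in wball n.
Proof. by apply: (@wball_le 0) => //; rewrite wball0 inE. Qed.

Lemma letter_wball s : s \in letters -> s \in wball 1.
Proof. by move=> sl; rewrite -[s]mulg1; apply: wballS => //; rewrite wball1. Qed.

Lemma wballM m n g h : g \in wball m -> h \in wball n -> (g * h)%g \in wball (m + n).
Proof.
elim: m g => [|m IH] g; first by rewrite inE => /eqP-> hb; rewrite mul1g.
move=> /wballSP[s sl [x xb ->]] hb; rewrite -mulgA addSn; apply: wballS => //.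
exact: IH.
Qed.

Lemma wballV n g : g \in wball n -> (g^-1)%g \in wball n.
Proof.
elim: n g => [|n IH] g; first by rewrite !inE => /eqP->; rewrite invg1.
move=> /wballSP[s sl [x /IH xb ->]]; rewrite invgM -addn1.
by apply: wballM => //; apply/letter_wball/lettersV.
Qed.

Hypothesis gensP : forall S : {pred G}, group_closed S -> {subset gens <= S} ->
  forall g, g \in S.

Lemma wball_cover g : exists n, g \in wball n.
Proof.
suff : g \in [pred g | `[< exists n, g \in wball n >]].
  by move=> /asboolP.
apply: gensP => [|s sg]; last first.
  apply/asboolP; exists 1%N; apply: letter_wball.
  by rewrite /letters !inE mem_cat sg orbT.
split=> [|x y]; first by apply/asboolP; exists 0%N; exact: wball1.
move=> /asboolP[m xm] /asboolP[n yn]; apply/asboolP.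
by exists (m + n)%N; apply: wballM => //; exact: wballV.
Qed.

(** If two consecutive balls coincide, then the ball is stable under
    multiplication by letters, hence is the whole group. *)
Lemma card_wball_lt : ~ (exists F : {fset G}, forall g, g \in F) ->
  forall n, (n < #|` wball n|)%N.
Proof.
move=> infG; elim=> [|n IH]; first by rewrite wball0 cardfs1.
rewrite -ltnS in IH; apply: leq_trans IH _.
apply: fproper_ltn_card; rewrite fproperEneq; apply/andP; split; last first.
  by apply/fsubsetP; exact: wball_leS.
apply/eqP => En; apply: infG; exists (wball n) => g.
have [m] := wball_cover g; elim: m g => [|m IHm] g.
  by rewrite wball0 inE => /eqP->; exact: wball1.
by move=> /wballSP[s sl [x /IHm xb ->]]; rewrite En; exact: wballS.
Qed.

Lemma fg_countable : countable [set: G].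
Proof.
have -> : [set: G] = \bigcup_(n in [set: nat]) [set` wball n].
  by rewrite eqEsubset; split=> // g _; have [n gn] := wball_cover g; exists n.
apply: bigcup_countable => // n _.
Qed.

End Balls.

(** * Words in virtually abelian groups *)

Section VirtuallyAbelian.
Variable H : groupType.
Variable A : {pred H}.
Hypothesis Agrp : group_closed A.
Hypothesis Acomm : {in A &, forall a b, commute a b}.
Variable ts : seq H.
Hypothesis ts_cover : forall g, exists2 t, t \in ts & (t^-1 * g)%g \in A.

Definition coset_rep (g : H) : H := sval (cid2 (ts_cover g)).

Lemma coset_rep_in g : coset_rep g \in ts.
Proof. by rewrite /coset_rep; case: cid2. Qed.

Lemma coset_repA g : ((coset_rep g)^-1 * g)%g \in A.
Proof. by rewrite /coset_rep; case: cid2. Qed.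

Definition prod_powers (Y : seq H) (c : H -> nat) : H :=
  (\prod_(y <- Y) y ^+ c y)%g.

Lemma powerA y n : y \in A -> (y ^+ n)%g \in A.
Proof.
move=> yA; elim: n => [|n IH]; first by rewrite expg0 (proj1 Agrp).
by rewrite expgS (group_closedM Agrp).
Qed.

Lemma prod_powersA Y c : {subset Y <= A} -> prod_powers Y c \in A.
Proof.
rewrite /prod_powers; elim: Y => [|y Y IH] YA.
  by rewrite big_nil (proj1 Agrp).
rewrite big_cons (group_closedM Agrp) //; first by apply/powerA/YA/mem_head.
by apply: IH => z zY; apply: YA; rewrite inE zY orbT.
Qed.

Lemma prod_powers_incr Y c y0 : {subset Y <= A} -> uniq Y -> y0 \in Y ->
  (y0 * prod_powers Y c)%g = prod_powers Y (fun y => (y == y0) + c y)%N.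
Proof.
rewrite /prod_powers; elim: Y => [//|y Y IH] YA /= /andP[yY uY].
have yA : y \in A by apply/YA/mem_head.
have {}YA : {subset Y <= A} by move=> z zY; apply: YA; rewrite inE zY orbT.
rewrite inE !big_cons; have [Ey _|ney /= yY0] := eqVneq y0 y; first subst y0.
  rewrite mulgA -expgS add1n; congr (_ * _)%g.
  apply: eq_big_seq => z zY; case: eqP => // zy; by rewrite zy (negbTE yY) in zY.
rewrite add0n -IH // !mulgA; congr (_ * _)%g.
by apply: Acomm; [exact: YA|exact: powerA].
Qed.

(** Read a product letter by letter and keep track of the representative of its
    coset. Then the letter [h] multiplies the part in [A] by the factor [y], and
    [y] takes finitely many values while [h] ranges over a finite set. *)
Lemma coset_step h q b :
  b \in A -> q = (coset_rep q * b * (coset_rep 1)^-1)%g ->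
  let y := ((coset_rep (h * q))^-1 * h * coset_rep q)%g in
  y \in A /\ (h * q = coset_rep (h * q) * (y * b) * (coset_rep 1)^-1)%g.
Proof.
move=> bA Eq y.
have Ehq : (h * q = coset_rep (h * q) * (y * b) * (coset_rep 1)^-1)%g.
  rewrite [in LHS]Eq /y -!mulgA mulVKg.
  by rewrite !mulgA.
split=> //.
have /(group_closedM Agrp) M := coset_repA (h * q).
have yb : (y * b * (coset_rep 1)^-1)%g \in A.
  have := coset_repA (h * q); rewrite [X in (_ * X)%g]Ehq -!mulgA mulKg.
  by rewrite !mulgA.
have r1 : (coset_rep 1) \in A.
  by rewrite -[coset_rep 1]invgK; apply: (group_closedV Agrp); rewrite -[X in X \in _]mulg1 coset_repA.
have {}yb : (y * b)%g \in A.
  by rewrite -[(y * b)%g](mulgVK (coset_rep 1)) (group_closedM Agrp).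
rewrite -[y](mulgK b); apply: (group_closedM Agrp) => //.
exact: (group_closedV Agrp).
Qed.

(** The factors [y] of [coset_step] for letters [h] in [S]. *)
Definition coset_steps (S : seq H) : seq H :=
  undup [seq y <- [seq (t^-1 * z)%g | t <- ts,
                     z <- [seq (s * t)%g | s <- S, t <- ts]] | y \in A].

Lemma coset_steps_uniq S : uniq (coset_steps S).
Proof. exact: undup_uniq. Qed.

Lemma coset_stepsA S : {subset coset_steps S <= A}.
Proof. by move=> y; rewrite mem_undup mem_filter => /andP[]. Qed.

Lemma mem_coset_steps S h q1 q2 : h \in S ->
  ((coset_rep q1)^-1 * h * coset_rep q2)%g \in A ->
  ((coset_rep q1)^-1 * h * coset_rep q2)%g \in coset_steps S.
Proof.
move=> hS yA; rewrite mem_undup mem_filter yA /= -mulgA.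
by apply: allpairs_f; [exact: coset_rep_in|apply: allpairs_f => //; exact: coset_rep_in].
Qed.

(** The factors produced by [coset_step] commute, so only their multiplicities
    matter, and these are at most the length of the word. *)
Lemma word_normal_form (gens : seq H) n g : g \in wball gens n ->
  exists2 c : H -> nat, (forall y, c y <= n)%N &
  g = (coset_rep g * prod_powers (coset_steps (letters gens)) c
       * (coset_rep 1)^-1)%g.
Proof.
elim: n g => [|n IH] g.
  rewrite wball0 inE => /eqP->; exists (fun=> 0%N) => //.
  by rewrite /prod_powers big1 ?mulg1 ?mulgV // => y _; rewrite expg0.
move=> /wballSP[s sl [x /IH[c cn Ex] ->]].
have [yA Esx] := coset_step s (prod_powersA c (@coset_stepsA _)) Ex.
set y0 := (_^-1 * s * _)%g in yA Esx.
exists (fun y => (y == y0) + c y)%N.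
  by move=> y; rewrite -add1n leq_add // leq_b1.
rewrite -prod_powers_incr //; first exact: coset_stepsA.
  exact: coset_steps_uniq.
exact: mem_coset_steps.
Qed.

Lemma card_wball_poly (gens : seq H) : exists K q : nat,
  forall n, (#|` wball gens n| <= K * n.+1 ^ q)%N.
Proof.
set Y := coset_steps (letters gens).
exists #|{: seq_sub ts}|, #|{: seq_sub Y}| => n.
pose T : finType := (seq_sub ts * {ffun seq_sub Y -> 'I_n.+1})%type.
pose F (z : T) : H := (val z.1 * prod_powers Y
   (fun y => if insub y is Some u then val (z.2 u) else 0%N) * (coset_rep 1)^-1)%g.
have sub : {subset wball gens n <= [seq F z | z <- enum T]}.
  move=> g /word_normal_form[c cn Eg]; apply/mapP.
  exists (SeqSub (coset_rep_in g), [ffun u => Ordinal (cn (val u) : (c (val u) < n.+1)%N)]).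
    by rewrite mem_enum.
  rewrite {1}Eg /F /=; congr (_ * _ * _)%g; apply: eq_big_seq => y yY.
  by case: insubP => [u _ uy|]; rewrite ?yY // ffunE /= uy.
have /= := uniq_leq_size (fset_uniq (wball gens n)) sub.
move=> /leq_trans; apply; by rewrite size_map -cardE card_prod card_ffun card_ord.
Qed.

End VirtuallyAbelian.

(** * Polynomial growth and Folner sets *)

Section Growth.
Variable R : realType.

Lemma exists_nat_ge (x : R) : exists n : nat, x <= n%:R.
Proof.
exists (Num.bound x); apply: le_trans (ler_norm _) _.
by apply/ltW; have := archi_boundP (normr_ge0 x); rewrite /Num.bound normr_id.
Qed.

Lemma ln_le_sqrt (x : R) : 0 < x -> ln x <= 2 * Num.sqrt x.
Proof.
move=> x0; have s0 : 0 < Num.sqrt x by rewrite sqrtr_gt0.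
rewrite -{1}(sqr_sqrtr (ltW x0)) lnXn // -[leLHS]mulr_natl ler_wpM2l //.
exact/ltW/ln_sublinear.
Qed.

Lemma ln_sublin (e : R) : 0 < e ->
  exists N : nat, forall n, (N <= n)%N -> ln (n.+1%:R : R) <= e * n%:R.
Proof.
move=> e0; have [N0 HN0] := exists_nat_ge (8 / e ^+ 2).
exists N0.+1 => n Nn.
have n1 : 1 <= n%:R :> R by rewrite ler1n; exact: leq_trans Nn.
apply: le_trans (ln_le_sqrt _) _; first by rewrite ltr0n.
have nN : 8 / e ^+ 2 <= n%:R by apply: le_trans HN0 _; rewrite ler_nat ltnW.
have en : 8 <= n%:R * e ^+ 2 by rewrite -ler_pdivrMr // exprn_gt0.
have en0 : 0 <= e * n%:R by rewrite mulr_ge0 // ltW.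
rewrite -(@ler_pXn2r _ 2) ?nnegrE ?mulr_ge0 ?sqrtr_ge0 //.
rewrite !exprMn sqr_sqrtr ?ler0n // -natr1.
  nra.
exact: ltW.
Qed.

(** Otherwise [a] would grow exponentially along the multiples of [k]. *)
Lemma slow_growth (a : nat -> nat) (K q : nat) :
  (forall n, 0 < a n)%N -> (forall n, a n <= K * n.+1 ^ q)%N ->
  forall k (d : R), 0 < d -> exists m, (a (m + k)%N)%:R <= (1 + d) * (a m)%:R.
Proof.
move=> a0 aK k d d0; apply: contrapT => /forallNP Hm.
have k0 : (0 < k)%N.
  rewrite lt0n; apply/eqP => k0; apply: (Hm 0%N); rewrite k0 addn0.
  by rewrite ler_peMl // ler_wpDr // ltW.
have d1 : 1 < 1 + d by rewrite ltrDl.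
have d10 : 0 < 1 + d by apply: lt_trans d1.
have aj j : (1 + d) ^+ j <= (a (j * k)%N)%:R.
  elim: j => [|j IH]; first by rewrite expr0 ler1n.
  have /negP := Hm (j * k)%N; rewrite -ltNge => /ltW; rewrite mulSn addnC.
  by apply: le_trans; rewrite exprS ler_wpM2l // ltW.
have K0 : (0 < K)%N.
  by have := leq_trans (a0 0%N) (aK 0%N); rewrite muln_gt0 => /andP[].
have lnd : 0 < ln (1 + d) by rewrite ln_gt0.
have lj j : j%:R * ln (1 + d) <= ln (K%:R : R) + q%:R * ln ((j * k).+1%:R : R).
  rewrite !mulr_natl -!lnXn // ?ltr0n // -lnM ?posrE ?ltr0n // ?exprn_gt0 ?ltr0n //.
  rewrite ler_ln ?posrE ?exprn_gt0 // ?mulr_gt0 ?exprn_gt0 ?ltr0n //.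
  apply: le_trans (aj j) _; apply: le_trans (_ : (K * (j * k).+1 ^ q)%:R <= _).
    by rewrite ler_nat.
  by rewrite natrM natrX.
pose e := ln (1 + d) / (2 * q.+1%:R * k%:R).
have qk : 0 < 2 * q.+1%:R * k%:R :> R by rewrite !mulr_gt0 ?ltr0n.
have e0 : 0 < e by rewrite divr_gt0.
have [N HN] := ln_sublin e0.
have [M HM] := exists_nat_ge (2 * ln (K%:R : R) / ln (1 + d)).
pose j := (N + M).+1.
have jk : (N <= j * k)%N.
  by apply: (@leq_trans j); [rewrite /j ltnW// ltnS leq_addr|rewrite leq_pmulr].
have := HN _ jk; have := lj j.
set E := ln ((j * k).+1%:R : R) => H1 H2.
have H3 : q%:R * E <= q.+1%:R * (e * (j * k)%:R).
  apply: ler_pM => //; last by rewrite ler_nat.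
  by rewrite ln_ge0 // ler1n.
have H4 : q.+1%:R * (e * (j * k)%:R) = ln (1 + d) / 2 * j%:R.
  rewrite /e natrM; have := qk; move: (q.+1%:R : R) (k%:R : R) => x y.
  move=> xy; have x0 : x != 0 by apply/eqP => x0; rewrite x0 mulr0 mul0r ltxx in xy.
  have y0 : y != 0 by apply/eqP => y0; rewrite y0 mulr0 ltxx in xy.
  by field; rewrite x0 y0.
have H5 : 2 * ln (K%:R : R) < ln (1 + d) * j%:R.
  move: HM; rewrite ler_pdivrMr // => HM; apply: le_lt_trans HM _.
  by rewrite mulrC ltr_pM2l // ltr_nat /j ltnS leq_addl.
lra.
Qed.


Section GroupGrowth.
Variable G : groupType.

Lemma card_translate (g : G) (F : {fset G}) : #|` translate g F| = #|` F|.
Proof. by rewrite card_imfset //=; exact: mulgI. Qed.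

Lemma translateE (g x : G) (F : {fset G}) :
  (x \in translate g F) = ((g^-1 * x)%g \in F).
Proof.
apply/imfsetP/idP => [[y yF ->]|xF]; first by rewrite mulKg.
by exists (g^-1 * x)%g => //; rewrite mulVKg.
Qed.

(** [F] and its translate have the same cardinality, hence so do the two halves
    of their symmetric difference. *)
Lemma card_fsym_diff_translate (g : G) (F : {fset G}) :
  (#|` fsym_diff (translate g F) F| <= 2 * #|` (translate g F `\` F)%fset|)%N.
Proof.
rewrite /fsym_diff; apply: leq_trans
  (leq_addr #|` (translate g F `\` F) `&` (F `\` translate g F)|%fset _) _.
rewrite cardfsUI mul2n -addnn leq_add2l.
suff: (#|` (translate g F `&` F)%fset| + #|` (F `\` translate g F)%fset|
   = #|` (translate g F `&` F)%fset| + #|` (translate g F `\` F)%fset|)%N.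
  by move/eqP; rewrite eqn_add2l => /eqP->.
by rewrite cardfsID card_translate [in LHS]fsetIC cardfsID.
Qed.

Variable gens : seq G.
Hypothesis gensP : forall S : {pred G}, group_closed S -> {subset gens <= S} ->
  forall g, g \in S.
Hypothesis va : virtually_abelian G.

Local Notation wball := (wball gens).

Lemma card_wball_gt0 n : (0 < #|` wball n|)%N.
Proof. by rewrite cardfs_gt0; apply/fset0Pn; exists 1%g; exact: wball1. Qed.

Lemma wball_slow_growth k (d : R) : 0 < d ->
  exists m, #|` wball (m + k)|%:R <= (1 + d) * #|` wball m|%:R.
Proof.
have [A [Agrp Acomm [ts tsP]]] := va.
have [K [q Kq]] := card_wball_poly Agrp Acomm tsP gens.
by move=> d0; apply: (@slow_growth (fun n => #|` wball n|) K q) => //; exact: card_wball_gt0.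
Qed.

Lemma folner_exists : exists F : nat -> {fset G}, folner_sequence R F.
Proof.
have d0 n : 0 < (n.+1%:R^-1 : R) by rewrite invr_gt0 ltr0n.
pose m n : nat := sval (cid (wball_slow_growth n (d0 n))).
have mP n : #|` wball (m n + n)|%:R <= (1 + n.+1%:R^-1) * #|` wball (m n)|%:R :> R.
  by rewrite /m; case: cid.
exists (fun n => wball (m n)); split=> [n|g].
  by rewrite -cardfs_gt0 card_wball_gt0.
have [k gk] := wball_cover gensP g.
apply: (@squeeze_cvgr _ _ _ _ (fun=> 0) (fun n => 2 * n.+1%:R^-1)); first last.
- by rewrite -[X in _ --> X](mulr0 2); apply: cvgMr; exact: cvg_harmonic.
- exact: cvg_cst.
near=> n; rewrite divr_ge0 ?ler0n //=.
have kn : (k <= n)%N by near: n; exact: nbhs_infty_ge.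
have b0 : 0 < #|` wball (m n)|%:R :> R by rewrite ltr0n card_wball_gt0.
rewrite ler_pdivrMr //.
apply: le_trans (_ : (2 * #|` (translate g (wball (m n)) `\` wball (m n))%fset|)%:R <= _).
  by rewrite ler_nat card_fsym_diff_translate.
rewrite natrM -mulrA ler_wpM2l //.
have : (#|` (translate g (wball (m n)) `\` wball (m n))%fset| + #|` wball (m n)| <=
   #|` wball (m n + n)|)%N.
  rewrite -(cardfsID (wball (m n)) (wball (m n + n))) addnC leq_add //.
    rewrite fsubset_leq_card //; apply/fsubsetP => x xb; rewrite inE xb andbT.
    by apply: wball_le xb; rewrite leq_addr.
  rewrite fsubset_leq_card //; apply/fsubsetP => x; rewrite !inE => /andP[-> /=].
  rewrite translateE => xg; rewrite -(mulVKg g x) addnC.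
  by apply: wballM => //; exact: wball_le gk.
rewrite -(@ler_nat R) natrD => /le_trans/(_ (mP n)).
by rewrite mulrDl mul1r addrC lerD2l.
Unshelve. all: end_near. Qed.

End GroupGrowth.

End Growth.

(** * Entropy of finite laws *)

Section FiniteEntropy.
Variable R : realType.
Implicit Types (T U I : finType).

Definition eta (x : R) : R := - (x * ln x).

Lemma eta0 : eta 0 = 0. Proof. by rewrite /eta mul0r oppr0. Qed.

Lemma eta1 : eta 1 = 0. Proof. by rewrite /eta ln1 mulr0 oppr0. Qed.

Lemma eta_ge0 x : x <= 1 -> 0 <= eta x.
Proof.
move=> x1; have [x0|x0] := leP x 0.
  by rewrite /eta ln0 // mulr0 oppr0.
by rewrite /eta -mulrN mulr_ge0 ?(ltW x0) // oppr_ge0 ln_le0.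
Qed.

Lemma eta_le_subr x : 0 <= x -> eta x <= 1 - x.
Proof.
rewrite le_eqVlt => /orP[/eqP<-|x0]; first by rewrite eta0 subr0.
have : ln (1 + (x^-1 - 1)) <= x^-1 - 1.
  by apply: le_ln1Dx; rewrite ltrBrDl subrr invr_gt0.
rewrite addrC subrK lnV ?posrE // => /(ler_wpM2l (ltW x0)).
by rewrite mulrBr mulr1 mulfV ?gt_eqF // mulrN.
Qed.

Lemma eta_le_sqrt x : 0 <= x -> eta x <= 2 * Num.sqrt x.
Proof.
rewrite le_eqVlt => /orP[/eqP<-|x0]; first by rewrite eta0 sqrtr0 mulr0.
have s0 : 0 < Num.sqrt x by rewrite sqrtr_gt0.
rewrite -{1}(sqr_sqrtr (ltW x0)) /eta lnXn // -mulrN.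
have := eta_le_subr (ltW s0); rewrite /eta.
move: (Num.sqrt x) s0 (ln _) => s s0 l h; rewrite -mulr_natr.
nra.
Qed.

(** The total mass of a law is arbitrary here: conditioning on an event will be
    expressed by restricting the law to it. *)
Definition push T U (f : T -> U) (p : T -> R) (u : U) : R :=
  \sum_(t | f t == u) p t.

Lemma push_comp T U I (f : T -> U) (g : U -> I) p :
  push g (push f p) = push (g \o f) p.
Proof.
apply/funext => i; rewrite /push (partition_big f (fun u => g u == i)) /=.
  apply: eq_bigr => u gu; apply: eq_bigl => t.
  by have [->|] := eqVneq; rewrite ?gu ?andbF.
by [].
Qed.

Lemma push_ge0 T U (f : T -> U) p u : (forall t, 0 <= p t) -> 0 <= push f p u.
Proof. by move=> p0; apply: sumr_ge0. Qed.

Lemma push_ge T U (f : T -> U) p t : (forall t, 0 <= p t) -> p t <= push f p (f t).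
Proof.
by move=> p0; rewrite /push (bigD1 t) //= lerDl sumr_ge0.
Qed.

Lemma push_sum T U (f : T -> U) p : \sum_u push f p u = \sum_t p t.
Proof. by rewrite /push (partition_big f predT). Qed.

Lemma push_sum_comp T U (f : T -> U) p (F : U -> R) :
  \sum_u push f p u * F u = \sum_t p t * F (f t).
Proof.
rewrite [RHS](partition_big f predT) //=; apply: eq_bigr => u _.
by rewrite /push mulr_suml; apply: eq_bigr => t /eqP->.
Qed.

Definition ent_law T (p : T -> R) : R := \sum_t eta (p t).

Lemma ent_pushE T U (f : T -> U) p :
  ent_law (push f p) = - \sum_t p t * ln (push f p (f t)).
Proof.
rewrite -(push_sum_comp f p (fun u => ln (push f p u))) -sumrN.
by apply: eq_bigr.
Qed.

(** Termwise this is [ln x <= x - 1] for [x = q t / p t]. *)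
Lemma gibbs T (p q : T -> R) :
  (forall t, 0 <= p t) -> (forall t, 0 <= q t) -> (forall t, 0 < p t -> 0 < q t) ->
  \sum_t q t <= \sum_t p t ->
  \sum_t p t * ln (q t) <= \sum_t p t * ln (p t).
Proof.
move=> p0 q0 pq qp; rewrite -subr_ge0 -sumrB.
apply: le_trans (_ : 0 <= \sum_t (p t - q t)) _; first by rewrite sumrB subr_ge0.
apply: ler_sum => t _; have := p0 t; rewrite le_eqVlt => /orP[/eqP<-|pt].
  by rewrite !mul0r subrr sub0r oppr_le0.
have qt := pq _ pt.
have : ln (1 + (q t / p t - 1)) <= q t / p t - 1.
  by apply: le_ln1Dx; rewrite ltrBrDl subrr divr_gt0.
rewrite addrC subrK ln_div ?posrE // => /(ler_wpM2l (ltW pt)).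
rewrite !mulrBr mulr1 mulrCA mulfV ?gt_eqF // mulr1; lra.
Qed.

(** Up to points of mass zero the fibres of [g] are contained in those of [f], so
    [push g p] is at most [push f p] along the two maps. *)
Lemma ent_push_le T U I (f : T -> U) (g : T -> I) p :
  (forall t, 0 <= p t) ->
  (forall s t, 0 < p s -> 0 < p t -> g s = g t -> f s = f t) ->
  ent_law (push f p) <= ent_law (push g p).
Proof.
move=> p0 gf; rewrite !ent_pushE lerN2; apply: ler_sum => t _.
have := p0 t; rewrite le_eqVlt => /orP[/eqP<-|pt]; first by rewrite !mul0r.
have gt0 : 0 < push g p (g t) by apply: lt_le_trans pt (push_ge _ _ p0).
have le : push g p (g t) <= push f p (f t).
  rewrite /push [leRHS]big_mkcond /= [leLHS]big_mkcond /=; apply: ler_sum => s _.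
  case: eqP => gst; last by case: ifP.
  have := p0 s; rewrite le_eqVlt => /orP[/eqP<-|ps]; first by case: ifP.
  by rewrite (gf s t) // eqxx.
by rewrite ler_wpM2l // ler_ln ?posrE // (lt_le_trans gt0).
Qed.

Lemma ent_push_eq T U I (f : T -> U) (g : T -> I) p :
  (forall t, 0 <= p t) ->
  (forall s t, g s = g t -> f s = f t) -> (forall s t, f s = f t -> g s = g t) ->
  ent_law (push f p) = ent_law (push g p).
Proof.
by move=> p0 gf fg; apply/eqP; rewrite eq_le !ent_push_le // => s t _ _; [exact: fg|exact: gf].
Qed.

(** Gibbs' inequality for the law [q = p13 p23 / p3], under which the first two
    coordinates are independent given the third. *)
Lemma ent_law_submod T1 T2 T3 (p : T1 * T2 * T3 -> R) :
  (forall t, 0 <= p t) ->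
  ent_law p + ent_law (push snd p) <=
  ent_law (push (fun z => (z.1.1, z.2)) p) + ent_law (push (fun z => (z.1.2, z.2)) p).
Proof.
move=> p0; rewrite !ent_pushE.
set p3 := push snd p; set p13 := push (fun z => (z.1.1, z.2)) p.
set p23 := push (fun z => (z.1.2, z.2)) p.
pose q (z : T1 * T2 * T3) := p13 (z.1.1, z.2) * p23 (z.1.2, z.2) / p3 z.2.
have p13E : push snd p13 = p3 by rewrite push_comp.
have p23E : push snd p23 = p3 by rewrite push_comp.
have p13_ge0 z : 0 <= p13 z by exact: push_ge0.
have p23_ge0 z : 0 <= p23 z by exact: push_ge0.
have p3_ge0 z : 0 <= p3 z by exact: push_ge0.
have p13_gt0 z : 0 < p z -> 0 < p13 (z.1.1, z.2).
  by move=> pz; apply: lt_le_trans pz (@push_ge _ _ (fun z => (z.1.1, z.2)) _ _ p0).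
have p23_gt0 z : 0 < p z -> 0 < p23 (z.1.2, z.2).
  by move=> pz; apply: lt_le_trans pz (@push_ge _ _ (fun z => (z.1.2, z.2)) _ _ p0).
have p3_gt0 z : 0 < p z -> 0 < p3 z.2.
  by move=> pz; apply: lt_le_trans pz (@push_ge _ _ snd _ _ p0).
have sum_q : \sum_t q t <= \sum_t p t.
  rewrite -(push_sum snd p) -/p3.
  pose F t3 (t12 : T1 * T2) := q (t12, t3).
  have -> : \sum_t q t = \sum_t3 \sum_t12 F t3 t12.
    by rewrite exchange_big pair_bigA /=; apply: eq_bigr => -[].
  apply: ler_sum => t3 _.
  have -> : \sum_t12 F t3 t12 = (\sum_t1 p13 (t1, t3)) * (\sum_t2 p23 (t2, t3)) / p3 t3.
    rewrite mulr_suml mulr_suml -(pair_bigA _ (fun t1 t2 => F t3 (t1, t2))) /=.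
    by apply: eq_bigr => t1 _; rewrite mulr_sumr mulr_suml.
  have marg (V : finType) (r : V * T3 -> R) : \sum_t1 r (t1, t3) = push snd r t3.
    rewrite /push (reindex_onto (fun v : V => (v, t3)) fst) /=; last first.
      by move=> [v t] /= /eqP->.
    by apply: eq_bigl => v; rewrite !eqxx.
  rewrite !marg p13E p23E.
  have [->|nz] := eqVneq (p3 t3) 0; first by rewrite mul0r mul0r.
  by rewrite mulfK.
have := @gibbs _ p q p0 _ _ sum_q.
have -> : \sum_t p t * ln (q t) = \sum_t p t * ln (p13 (t.1.1, t.2))
   + \sum_t p t * ln (p23 (t.1.2, t.2)) - \sum_t p t * ln (p3 t.2).
  rewrite -big_split -sumrB /=; apply: eq_bigr => t _.
  have := p0 t; rewrite le_eqVlt => /orP[/eqP<-|pt]; first by rewrite !mul0r addr0 subr0.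
  rewrite /q ln_div ?posrE ?mulr_gt0 ?p13_gt0 ?p23_gt0 ?p3_gt0 //.
  by rewrite lnM ?posrE ?p13_gt0 ?p23_gt0 //; ring.
move=> /(_ (fun t => divr_ge0 (mulr_ge0 (p13_ge0 _) (p23_ge0 _)) (p3_ge0 _))).
move=> /(_ (fun t pt => divr_gt0 (mulr_gt0 (p13_gt0 _ pt) (p23_gt0 _ pt)) (p3_gt0 _ pt))).
rewrite /ent_law sumrN; lra.
Qed.

Lemma ent_push_submod T T1 T2 T3 (f : T -> T1) (g : T -> T2) (h : T -> T3) p :
  (forall t, 0 <= p t) ->
  ent_law (push (fun t => (f t, g t, h t)) p) + ent_law (push h p) <=
  ent_law (push (fun t => (f t, h t)) p) + ent_law (push (fun t => (g t, h t)) p).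
Proof.
move=> p0; have := @ent_law_submod _ _ _ (push (fun t => (f t, g t, h t)) p).
by rewrite !push_comp; apply => t; exact: push_ge0.
Qed.

Lemma ent_push_unit T p :
  ent_law (push (fun _ : T => tt) p) = eta (\sum_t p t).
Proof. by rewrite /ent_law (bigD1 tt) //= big1 ?addr0 // => -[]. Qed.

Lemma ent_push_subadd T T1 T2 (f : T -> T1) (g : T -> T2) p :
  (forall t, 0 <= p t) ->
  ent_law (push (fun t => (f t, g t)) p) + eta (\sum_t p t) <=
  ent_law (push f p) + ent_law (push g p).
Proof.
move=> p0; rewrite -ent_push_unit.
have := @ent_push_submod _ _ _ _ f g (fun=> tt) p p0.
rewrite (@ent_push_eq _ _ _ (fun t => (f t, g t, tt)) (fun t => (f t, g t))) //; last 2 first.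
- by move=> s t [-> ->].
- by move=> s t [-> ->].
rewrite (@ent_push_eq _ _ _ (fun t => (f t, tt)) f) //; last 2 first.
- by move=> s t ->.
- by move=> s t [].
rewrite (@ent_push_eq _ _ _ (fun t => (g t, tt)) g) //.
- by move=> s t ->.
- by move=> s t [].
Qed.

Lemma push_id T (p : T -> R) : push id p = p.
Proof. by apply/funext => t; rewrite /push big_pred1_eq. Qed.

Lemma ent_law_le_card T (p : T -> R) : (forall t, 0 <= p t) ->
  ent_law p <= eta (\sum_t p t) + (\sum_t p t) * ln #|T|%:R.
Proof.
move=> p0; set m := \sum_t p t.
have m0 : 0 <= m by exact: sumr_ge0.
have := m0; rewrite le_eqVlt => /orP[/eqP mE|mgt].
  have pE t : p t = 0.
    apply/eqP; rewrite eq_le p0 andbT mE /m (bigD1 t) //= lerDl.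
    exact: sumr_ge0.
  rewrite -mE eta0 mul0r addr0 /ent_law big1 // => t _; by rewrite pE eta0.
have T0 : (0 < #|T|)%N.
  rewrite lt0n; apply/eqP => /eqP; rewrite -leqn0 leqNgt => /negP T0; move: mgt.
  rewrite /m big1 ?ltxx // => t _; case: T0; apply/card_gt0P; by exists t.
have c0 : 0 < #|T|%:R :> R by rewrite ltr0n.
have := @gibbs _ p (fun=> m / #|T|%:R) p0 _ _ _.
have -> : \sum_(t : T) m / #|T|%:R = m.
  by rewrite sumr_const -[LHS]mulr_natr divfK ?gt_eqF.
move=> /(_ (fun=> divr_ge0 m0 (ltW c0)) (fun _ _ => divr_gt0 mgt c0) (lexx _)).
rewrite -mulr_suml -/m ln_div ?posrE // /ent_law sumrN /eta; lra.
Qed.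

(** Concavity of the entropy, as subadditivity for the joint law of index and
    value. *)
Lemma ent_law_superadd I T (p : I -> T -> R) : (forall i t, 0 <= p i t) ->
  \sum_i (ent_law (p i) - eta (\sum_t p i t)) <=
  ent_law (fun t => \sum_i p i t) - eta (\sum_t \sum_i p i t).
Proof.
move=> p0; pose P (z : I * T) := p z.1 z.2.
have := @ent_push_subadd _ _ _ fst snd P (fun z => p0 _ _).
have -> : push (fun t => (t.1, t.2)) P = P.
  by rewrite -[RHS]push_id; congr push; apply/funext => -[].
have -> : \sum_t P t = \sum_t \sum_i p i t.
  by rewrite exchange_big pair_bigA.
have -> : push fst P = (fun i => \sum_t p i t).
  apply/funext => i; rewrite /push (reindex_onto (fun t => (i, t)) snd) /=.
    by apply: eq_bigl => t; rewrite !eqxx.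
  by move=> [v t] /= /eqP->.
have -> : push snd P = (fun t => \sum_i p i t).
  apply/funext => i; rewrite /push (reindex_onto (fun t => (t, i)) fst) /=.
    by apply: eq_bigl => t; rewrite !eqxx.
  by move=> [v t] /= /eqP->.
have -> : ent_law P = \sum_i ent_law (p i).
  by rewrite /ent_law pair_bigA.
rewrite sumrB /ent_law; lra.
Qed.

End FiniteEntropy.

(** * Discrete random variables *)

Lemma countable_bigcup_measurable_in d (T : measurableType d) U (D : set U)
    (F : U -> set T) : countable D ->
  (forall i, D i -> measurable (F i)) -> measurable (\bigcup_(i in D) F i).
Proof.
move=> /countable_injP[f finj] mF.
have -> : \bigcup_(i in D) F i =
    \bigcup_(n in [set: nat]) \bigcup_(i in D `&` f @^-1` [set n]) F i.
  rewrite eqEsubset; split=> [x [i Di Fi]|x [n _ [i [Di _] Fi]]]; last by exists i.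
  by exists (f i) => //; exists i.
apply: bigcup_measurable => n _.
have [->|/set0P[i [Di /= fi]]] := eqVneq (D `&` f @^-1` [set n]) set0.
  by rewrite bigcup_set0.
have -> : D `&` f @^-1` [set n] = [set i].
  rewrite eqEsubset; split=> [j [Dj /= fj]|j ->]; last by [].
  by apply: finj; rewrite ?inE // fj fi.
by rewrite bigcup_set1; exact: mF.
Qed.

Section Discrete.
Context d (X : measurableType d).

(** Cocycles take values in groups that carry no sigma-algebra. The countable
    range makes the preimage of every subset measurable. *)
Definition dmeas (S : Type) (f : X -> S) : Prop :=
  countable (range f) /\ forall s, measurable (f @^-1` [set s]).

Lemma dmeas_preimage S (f : X -> S) (B : set S) : dmeas f -> measurable (f @^-1` B).
Proof.
move=> [fc fm].
have -> : f @^-1` B = \bigcup_(s in range f `&` B) (f @^-1` [set s]).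
  rewrite eqEsubset; split=> [x Bfx|x [s [_ Bs] /= ->]] //.
  by exists (f x).
apply: countable_bigcup_measurable_in => //.
by apply: (@sub_countable _ _ _ (range f)) => //; apply: subset_card_le => s [].
Qed.

Lemma dmeas_comp S T (F : S -> T) (f : X -> S) : dmeas f -> dmeas (F \o f).
Proof.
move=> df; split=> [|t]; last by rewrite comp_preimage; exact: dmeas_preimage.
have -> : range (F \o f) = F @` range f by rewrite image_comp.
apply: (@sub_countable _ _ _ (range f)); last exact: df.1.
exact: card_image_le.
Qed.

Lemma dmeas_pair S T (f : X -> S) (g : X -> T) :
  dmeas f -> dmeas g -> dmeas (fun x => (f x, g x)).
Proof.
move=> df dg; split=> [|[s t]].
  apply: (@sub_countable _ _ _ (range f `*` range g)); last first.
    exact: countableX df.1 dg.1.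
  by apply: subset_card_le => _ [x _ <-]; split; exists x.
have -> : (fun x => (f x, g x)) @^-1` [set (s, t)] = f @^-1` [set s] `&` g @^-1` [set t].
  by rewrite eqEsubset; split=> [x [<- <-]|x [/= <- <-]].
by apply: measurableI; [exact: df.2|exact: dg.2].
Qed.

Lemma dmeas_cst S (s : S) : dmeas (fun _ : X => s).
Proof.
split=> [|t].
  apply: (@sub_countable _ _ _ [set s]); last exact: countable1.
  by apply: subset_card_le => _ [x _ <-].
by rewrite preimage_cst; case: ifP.
Qed.

Lemma dmeas_fin (T : finType) (f : X -> T) :
  (forall t, measurable (f @^-1` [set t])) -> dmeas f.
Proof. by move=> fm; split=> //; exact: (@countableP T). Qed.

Lemma dmeas_bool (A : set X) : measurable A -> dmeas (fun x => `[< A x >]).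
Proof.
move=> mA; apply: dmeas_fin => -[].
  have -> : (fun x => `[< A x >]) @^-1` [set true] = A.
    by rewrite eqEsubset; split=> x /=; [move/asboolP|move=> ?; apply/asboolP].
  by [].
have -> : (fun x => `[< A x >]) @^-1` [set false] = ~` A.
  by rewrite eqEsubset; split=> x /=; [move/asboolPn|move=> ?; apply/asboolPn].
exact: measurableC.
Qed.

Lemma dmeas_transform S (f : X -> S) (a : X -> X) :
  measurable_fun setT a -> dmeas f -> dmeas (f \o a).
Proof.
move=> ma df; split=> [|s].
  apply: (@sub_countable _ _ _ (range f)); last exact: df.1.
  by apply: subset_card_le => _ [x _ <-]; exists (a x).
by rewrite comp_preimage -[X in measurable X]setTI; apply: ma => //; exact: df.2.
Qed.

Lemma dmeas_ffun (I : finType) (T : finType) (f : I -> X -> T) :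
  (forall i, dmeas (f i)) -> dmeas (fun x => [ffun i => f i x]).
Proof.
move=> df; apply: dmeas_fin => t.
have -> : (fun x => [ffun i => f i x]) @^-1` [set t] =
    \bigcap_(i in [set: I]) (f i @^-1` [set t i]).
  rewrite eqEsubset; split=> [x /= <- i _|x h] /=; first by rewrite ffunE.
  by apply/ffunP => i; rewrite ffunE; exact: h.
by apply: fin_bigcap_measurable => // i _; exact: (df i).2.
Qed.

End Discrete.

Section Entropy.
Context (R : realType) d (X : measurableType d).
Variable mu : probability X R.
Implicit Types (A B : set X) (T U : finType).

Definition pr A : R := fine (mu A).

Lemma prE A : measurable A -> mu A = (pr A)%:E.
Proof. by move=> mA; rewrite /pr fineK // fin_num_measure. Qed.

Lemma pr_ge0 A : 0 <= pr A. Proof. by rewrite /pr fine_ge0. Qed.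

Lemma pr0 : pr set0 = 0. Proof. by rewrite /pr measure0. Qed.

Lemma prT : pr setT = 1. Proof. by rewrite /pr probability_setT. Qed.

Lemma pr_mono A B : measurable A -> measurable B -> A `<=` B -> pr A <= pr B.
Proof.
by move=> mA mB AB; rewrite -lee_fin -!prE //; apply: le_measure; rewrite ?inE.
Qed.

Lemma pr_le1 A : measurable A -> pr A <= 1.
Proof. by move=> mA; rewrite -prT; exact: pr_mono. Qed.

Lemma pr_bigcup (I : choiceType) (D : {fset I}) (F : I -> set X) :
  (forall i, i \in D -> measurable (F i)) -> trivIset [set` D] F ->
  pr (\bigcup_(i in [set` D]) F i) = \sum_(i <- D) pr (F i).
Proof.
move=> mF tF; apply: EFin_inj; rewrite -prE; last exact: fin_bigcup_measurable.
rewrite bigcup_fset measure_fbigsetU // -sumEFin.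
by apply: eq_big_seq => i iD; exact/prE/mF.
Qed.

Lemma pr_bigcup_le (I : eqType) (s : seq I) (F : I -> set X) :
  (forall i, i \in s -> measurable (F i)) ->
  pr (\bigcup_(i in [set` s]) F i) <= \sum_(i <- s) pr (F i).
Proof.
elim: s => [|i s IH] mF.
  rewrite big_nil (_ : \bigcup_(i in _) F i = set0) ?pr0 //.
  by rewrite -subset0 => x [].
have mi : measurable (F i) by exact/mF/mem_head.
have ms j : j \in s -> measurable (F j) by move=> js; apply: mF; rewrite inE js orbT.
have mU : measurable (\bigcup_(i in [set` s]) F i).
  apply: fin_bigcup_measurable => //; exact: finite_seq.
rewrite big_cons; apply: le_trans (_ : pr (F i `|` \bigcup_(i in [set` s]) F i) <= _).
  apply: pr_mono; [|exact: measurableU|].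
    by apply: fin_bigcup_measurable => //; exact: finite_seq.
  move=> x [j /=]; rewrite inE => /orP[/eqP->|js] Fj; first by left.
  by right; exists j.
apply: le_trans (lerD (lexx _) (IH ms)).
rewrite -lee_fin EFinD -!prE //; last exact: measurableU.
exact: measureU2.
Qed.

Lemma prC A : measurable A -> pr (~` A) = 1 - pr A.
Proof.
move=> mA; apply: EFin_inj; rewrite EFinB -!prE //; last exact: measurableC.
exact: probability_setC.
Qed.

Lemma pr_split (T : finType) (f : X -> T) B : measurable B -> dmeas f ->
  pr B = \sum_t pr (B `&` f @^-1` [set t]).
Proof.
move=> mB df; have mF t : measurable (B `&` f @^-1` [set t]).
  by apply: measurableI => //; exact: df.2.
have -> : \sum_t pr (B `&` f @^-1` [set t]) =
    \sum_(t <- [fset t | t in T]%fset) pr (B `&` f @^-1` [set t]).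
  rewrite -big_enum /=; apply: perm_big; apply: uniq_perm; rewrite ?enum_uniq ?fset_uniq //.
  by move=> t; rewrite mem_enum !inE.
rewrite -pr_bigcup //.
  congr pr; rewrite eqEsubset; split=> [x Bx|x [t _ []]] //.
  by exists (f x) => //=; rewrite !inE.
by move=> t u _ _ [x [[_ /= <-] [_ /= <-]]].
Qed.

Definition law B T (f : X -> T) (t : T) : R := pr (B `&` f @^-1` [set t]).

(** The entropy of [f] for the conditional measure on [B], multiplied by the
    measure of [B]. This makes averages over the cells of a partition plain sums
    and keeps null cells harmless. *)
Definition ent B T (f : X -> T) : R := ent_law (law B f) - eta (pr B).

Lemma law_ge0 B T (f : X -> T) t : 0 <= law B f t. Proof. exact: pr_ge0. Qed.

Lemma law_sum B T (f : X -> T) : measurable B -> dmeas f ->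
  \sum_t law B f t = pr B.
Proof. by move=> mB df; rewrite -pr_split. Qed.

Lemma law_comp B T U (F : T -> U) (f : X -> T) : measurable B -> dmeas f ->
  law B (F \o f) = push F (law B f).
Proof.
move=> mB df; apply/funext => u; rewrite /law /push.
rewrite (pr_split _ df); last by apply: measurableI => //; exact: (dmeas_comp F df).2.
rewrite [RHS]big_mkcond; apply: eq_bigr => t _; case: eqP => [<-|ne].
  congr pr; rewrite eqEsubset; split=> x /=; first by move=> [[]].
  by move=> [Bx <-].
rewrite (_ : _ `&` _ = set0) ?pr0 // -subset0 => x /= [[_ Fu] ft].
by apply: ne; rewrite -ft.
Qed.

Lemma law_gt0 B T (f : X -> T) t : 0 < law B f t -> exists2 x, B x & f x = t.
Proof.
rewrite /law => h; have [e|/set0P[x [Bx fx]]] := eqVneq (B `&` f @^-1` [set t]) set0.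
  by rewrite e pr0 ltxx in h.
by exists x.
Qed.

(** Values of positive mass on [B] are attained in [B], so it suffices that [g]
    determines [f] there. *)
Lemma ent_le B T U (f : X -> T) (g : X -> U) : measurable B -> dmeas f -> dmeas g ->
  (forall x y, B x -> B y -> g x = g y -> f x = f y) -> ent B f <= ent B g.
Proof.
move=> mB df dg gf; rewrite /ent lerD2r; have dfg := dmeas_pair df dg.
rewrite (_ : f = fst \o (fun x => (f x, g x))) // (_ : g = snd \o (fun x => (f x, g x))) //.
rewrite !law_comp //; apply: ent_push_le => [t|]; first exact: law_ge0.
move=> [t u] [t' u'] /law_gt0[x Bx [<- <-]] /law_gt0[y By [<- <-]] /=.
exact: gf.
Qed.

Lemma ent_eq B T U (f : X -> T) (g : X -> U) : measurable B -> dmeas f -> dmeas g ->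
  (forall x y, B x -> B y -> g x = g y -> f x = f y) ->
  (forall x y, B x -> B y -> f x = f y -> g x = g y) -> ent B f = ent B g.
Proof. by move=> mB df dg h1 h2; apply/eqP; rewrite eq_le !ent_le. Qed.

Lemma ent_submod B T1 T2 T3 (f : X -> T1) (g : X -> T2) (h : X -> T3) :
  measurable B -> dmeas f -> dmeas g -> dmeas h ->
  ent B (fun x => (f x, g x, h x)) + ent B h <=
  ent B (fun x => (f x, h x)) + ent B (fun x => (g x, h x)).
Proof.
move=> mB df dg dh; rewrite /ent.
have dF := dmeas_pair (dmeas_pair df dg) dh.
pose F x := (f x, g x, h x).
have := @ent_push_submod R _ _ _ _ (fun z => z.1.1) (fun z => z.1.2) snd (law B F) (law_ge0 _ _).
rewrite -!law_comp // /comp /=; set E1 := ent_law _; set E2 := ent_law _; set E3 := ent_law _.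
set E4 := ent_law _; lra.
Qed.

Lemma ent_const B (c : unit) : measurable B -> ent B (fun=> c) = 0.
Proof.
move=> mB; rewrite /ent /ent_law (bigD1 tt) //= big1 => [|[]] //.
rewrite addr0 /law (_ : _ `&` _ = B) ?subrr //.
by rewrite eqEsubset; split=> [x []|x Bx] //; split=> //=; case: c.
Qed.

Lemma ent_pair_le B T1 T2 (f : X -> T1) (g : X -> T2) :
  measurable B -> dmeas f -> dmeas g ->
  ent B (fun x => (f x, g x)) <= ent B f + ent B g.
Proof.
move=> mB df dg; have dt := dmeas_cst X tt.
have := ent_submod mB df dg dt; rewrite ent_const // addr0 => h.
apply: le_trans (_ : ent B (fun x => (f x, g x, tt)) <= _).
  apply: ent_le => // [||x y _ _ [-> ->]] //; first exact: dmeas_pair.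
  exact: (dmeas_pair (dmeas_pair df dg) dt).
apply: le_trans h _; apply: lerD; apply: ent_le => //.
- exact: dmeas_pair.
- by move=> x y _ _ ->.
- exact: dmeas_pair.
- by move=> x y _ _ ->.
Qed.

Lemma ent_ge0 B T (f : X -> T) : measurable B -> dmeas f -> 0 <= ent B f.
Proof.
move=> mB df; rewrite -(ent_const tt mB); apply: ent_le => //; exact: dmeas_cst.
Qed.

Lemma ent_le_card B T (f : X -> T) : measurable B -> dmeas f ->
  ent B f <= pr B * ln #|T|%:R.
Proof.
move=> mB df; rewrite /ent lerBlDl -(law_sum mB df).
by apply: ent_law_le_card => t; exact: law_ge0.
Qed.

Lemma ent_chain B T U (f : X -> T) (c : X -> U) : measurable B -> dmeas f -> dmeas c ->
  ent B (fun x => (f x, c x)) =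
  ent B c + \sum_u ent (B `&` c @^-1` [set u]) f.
Proof.
move=> mB df dc; rewrite /ent sumrB [in X in _ - X]/=.
have -> : ent_law (law B (fun x => (f x, c x))) =
    \sum_u ent_law (law (B `&` c @^-1` [set u]) f).
  rewrite /ent_law exchange_big pair_bigA /=; apply: eq_bigr => -[t u] _ /=.
  congr eta; rewrite /law; congr pr; rewrite eqEsubset.
  by split=> [x [Bx [<- <-]]|x [[Bx /= <-] /= <-]].
rewrite [X in _ = _ + (_ - X)](_ : _ = ent_law (law B c)) //.
by rewrite [RHS]addrC addrA subrK.
Qed.

Lemma law_transform T (f : X -> T) (a : X -> X) :
  (forall A, measurable A -> mu (a @^-1` A) = mu A) -> dmeas f ->
  law setT (f \o a) = law setT f.
Proof.
move=> pa df; apply/funext => t; rewrite /law /pr !setTI comp_preimage pa //.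
exact: df.2.
Qed.

Lemma ent_transform T (f : X -> T) (a : X -> X) :
  (forall A, measurable A -> mu (a @^-1` A) = mu A) -> dmeas f ->
  ent setT (f \o a) = ent setT f.
Proof. by move=> pa df; rewrite /ent law_transform. Qed.

Lemma pr_setI_conull A B : measurable A -> measurable B -> mu A = 1%E ->
  pr (A `&` B) = pr B.
Proof.
move=> mA mB A1; have nA : mu (~` A) = 0%E by rewrite probability_setC // A1 subee.
apply/eqP; rewrite eq_le pr_mono //=; last exact: measurableI.
apply: le_trans (_ : pr ((A `&` B) `|` ~` A) <= _).
  apply: pr_mono => //.
    by apply: measurableU; [exact: measurableI|exact: measurableC].
  by move=> x Bx; have [Ax|nAx] := pselect (A x); [left|right].
by rewrite /pr measureU0 //; [exact: measurableI|exact: measurableC].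
Qed.

Lemma ent_conull A T (f : X -> T) : measurable A -> mu A = 1%E -> dmeas f ->
  ent setT f = ent A f.
Proof.
move=> mA A1 df; rewrite /ent /pr A1 probability_setT; congr (_ - _).
apply: eq_bigr => t _; congr eta; rewrite /law setTI pr_setI_conull //.
exact: df.2.
Qed.

End Entropy.

(** * Shearer's inequality *)

(** By submodularity, adding a point [z] to [W] increases [F W] by at most the
    increase of each [F (S d)] with [z] in [S d], and by at most [F] of the
    singleton; the singletons make up for the coverage that is missing. *)
Lemma shearer (R : realType) (K L : choiceType) (F : {fset K} -> R)
    (D : {fset L}) (S : L -> {fset K}) (k : nat) (W : {fset K}) :
  F fset0 = 0 ->
  (forall (A B : {fset K}) z, (A `<=` B)%fset -> z \notin B ->
     F (z |` B)%fset - F B <= F (z |` A)%fset - F A) ->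
  (forall w, count (fun d => w \in S d) D <= k)%N ->
  k%:R * F W <= \sum_(d <- D) F (S d `&` W)%fset
     + \sum_(w <- W) (k - count (fun d => w \in S d) D)%:R * F [fset w]%fset.
Proof.
move=> F0 Fsub cov; elim/fset1U_rect: W => [|z W zW IH].
  rewrite F0 mulr0 big_seq_fset0 addr0 big1 // => d _.
  by rewrite fsetI0 F0.
set m := count (fun d => z \in S d) D.
set delta := F (z |` W)%fset - F W.
have h1 : \sum_(d <- D) F (S d `&` W)%fset + m%:R * delta <=
    \sum_(d <- D) F (S d `&` (z |` W))%fset.
  rewrite /m -sum1_count natr_sum mulr_suml [X in _ + X]big_mkcond -big_split /=.
  apply: ler_sum => d _; case: ifP => [zS|/negP zS]; last first.
    rewrite addr0 (_ : (S d `&` (z |` W) = S d `&` W)%fset) //.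
    apply/fsetP => x; rewrite !inE; case: eqP => //= ->.
    by rewrite (negbTE zW); move/negP/negbTE: zS => ->.
  have -> : (S d `&` (z |` W) = z |` (S d `&` W))%fset.
    by apply/fsetP => x; rewrite !inE; case: eqP => //= ->; rewrite zS.
  have := Fsub (S d `&` W)%fset W z (fsubsetIr _ _) zW.
  rewrite mul1r -/delta; lra.
have h2 : delta <= F [fset z]%fset.
  have := Fsub fset0 W z (fsub0set _) zW; rewrite F0 subr0 fsetU0; exact.
have h3 : 0 <= (k - m)%:R :> R by rewrite ler0n.
have h4 : k%:R = m%:R + (k - m)%:R :> R by rewrite -natrD subnKC ?cov.
rewrite big_fsetU1 //= -/m.
have h5 : k%:R * F (z |` W)%fset = k%:R * F W + (m%:R + (k - m)%:R) * delta.
  by rewrite -h4 /delta mulrBr addrC subrK.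
rewrite h5 mulrDl; have := ler_wpM2l h3 h2; lra.
Qed.

Section Joint.
Context (R : realType) d (X : measurableType d).
Variable mu : probability X R.
Variables (K : choiceType) (J : finType) (f : K -> X -> J).
Hypothesis df : forall k, dmeas (f k).

Definition joint (A : {fset K}) (x : X) : {ffun A -> J} := [ffun a => f (val a) x].

Lemma joint_eqP A x y : joint A x = joint A y <-> {in A, forall a, f a x = f a y}.
Proof.
split=> [/ffunP h a aA|h]; first by have := h [` aA]%fset; rewrite !ffunE.
by apply/ffunP => a; rewrite !ffunE h //; exact: valP.
Qed.

Lemma dmeas_joint A : dmeas (joint A).
Proof. by apply: dmeas_ffun => a; exact: df. Qed.

Lemma ent_joint0 B : measurable B -> ent mu B (joint fset0) = 0.
Proof.
move=> mB; rewrite -(ent_const mu tt mB); apply: ent_eq => //.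
- exact: dmeas_joint.
- exact: dmeas_cst.
- by move=> x y _ _ _; apply/joint_eqP => a; rewrite inE.
Qed.

Lemma ent_joint1 B k : measurable B ->
  ent mu B (joint [fset k]%fset) <= pr mu B * ln #|J|%:R.
Proof.
move=> mB; apply: le_trans (ent_le_card mu mB (df k)).
apply: ent_le => //; first exact: dmeas_joint.
by move=> x y _ _ h; apply/joint_eqP => a; rewrite inE => /eqP->.
Qed.

Lemma ent_joint_submod B0 (A B : {fset K}) z : measurable B0 -> (A `<=` B)%fset ->
  ent mu B0 (joint (z |` B)%fset) - ent mu B0 (joint B) <=
  ent mu B0 (joint (z |` A)%fset) - ent mu B0 (joint A).
Proof.
move=> mB /fsubsetP AB.
have := ent_submod mu mB (df z) (dmeas_joint B) (dmeas_joint A).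
have -> : ent mu B0 (fun x => (joint B x, joint A x)) = ent mu B0 (joint B).
  apply: ent_eq => //; [|exact: dmeas_joint| |by move=> x y _ _ [-> _]].
    by apply: dmeas_pair; exact: dmeas_joint.
  move=> x y _ _ e; rewrite e; congr (_, _); apply/joint_eqP => a /AB aB.
  by move/joint_eqP: e => /(_ a aB).
have -> : ent mu B0 (fun x => (f z x, joint B x, joint A x)) = ent mu B0 (joint (z |` B)%fset).
  apply: ent_eq => //; last 2 first.
  - move=> x y _ _ /joint_eqP e; congr (_, _, _).
    + by apply: e; rewrite fset1U1.
    + by apply/joint_eqP => a aB; apply: e; rewrite inE aB orbT.
    + by apply/joint_eqP => a /AB aB; apply: e; rewrite inE aB orbT.
  - move=> x y _ _ [e1 /joint_eqP e2 _]; apply/joint_eqP => a; rewrite !inE => /orP[/eqP->//|].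
    exact: e2.
  - by apply: dmeas_pair; [apply: dmeas_pair => //|]; exact: dmeas_joint.
  - exact: dmeas_joint.
have -> : ent mu B0 (fun x => (f z x, joint A x)) = ent mu B0 (joint (z |` A)%fset).
  apply: ent_eq => //; last 2 first.
  - move=> x y _ _ /joint_eqP e; congr (_, _).
    + by apply: e; rewrite fset1U1.
    + by apply/joint_eqP => a aB; apply: e; rewrite inE aB orbT.
  - move=> x y _ _ [e1 /joint_eqP e2]; apply/joint_eqP => a; rewrite !inE => /orP[/eqP->//|].
    exact: e2.
  - by apply: dmeas_pair => //; exact: dmeas_joint.
  - exact: dmeas_joint.
lra.
Qed.

End Joint.

Section GroupShearer.
Context (R : realType) d (X : measurableType d).
Variable mu : probability X R.
Variables (H : groupType) (J : finType) (f : H -> X -> J).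
Hypothesis df : forall k, dmeas (f k).

Definition rtranslate (E : {fset H}) (h : H) : {fset H} := [fset (e * h)%g | e in E]%fset.

Lemma mem_rtranslate E h x : (x \in rtranslate E h) = ((x * h^-1)%g \in E).
Proof.
apply/imfsetP/idP => [[e eE ->]|xE]; first by rewrite mulgK.
by exists (x * h^-1)%g => //; rewrite mulgVK.
Qed.

Lemma card_rtranslate E h : #|` rtranslate E h| = #|` E|.
Proof. by rewrite card_imfset //=; exact: mulIg. Qed.

(** The translates of [E] by the elements of [D] cover every point of [W] at most
    [|E|] times, and [|E| |D|] times altogether, so the missing coverage is
    [|E| (|W| - |D|)]. *)
Lemma group_shearer B (E D W : {fset H}) : measurable B ->
  (forall e h, e \in E -> h \in D -> (e * h)%g \in W) ->
  #|` E|%:R * ent mu B (joint f W) <=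
  \sum_(h <- D) ent mu B (joint f (rtranslate E h))
  + #|` E|%:R * ((#|` W|%:R - #|` D|%:R) * (pr mu B * ln #|J|%:R)).
Proof.
move=> mB EDW; set F := fun A => ent mu B (joint f A).
have cov w : (count (fun h => w \in rtranslate E h) D <= #|` E|)%N.
  rewrite -size_filter -(size_map (fun h => w * h^-1)%g).
  apply: uniq_leq_size.
    rewrite map_inj_in_uniq ?filter_uniq ?fset_uniq // => x y _ _ /mulgI.
    exact: invg_inj.
  move=> x /mapP[h]; rewrite mem_filter => /andP[wh _ ->].
  by rewrite -mem_rtranslate.
have := @shearer R H H F D (rtranslate E) #|` E| W (ent_joint0 mu df mB) _ cov.
move=> /(_ (fun A C z AC _ => ent_joint_submod mu df z mB AC)) /le_trans; apply.
apply: lerD.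
  rewrite big_seq [leRHS]big_seq; apply: ler_sum => h hD.
  rewrite (_ : (rtranslate E h `&` W = rtranslate E h)%fset) //.
  apply/fsetIidPl/fsubsetP => x; rewrite mem_rtranslate => xE.
  by rewrite -(mulgVK h x) EDW.
apply: le_trans (_ : \sum_(w <- W)
   (#|` E| - count (fun h => w \in rtranslate E h) D)%:R * (pr mu B * ln #|J|%:R) <= _).
  by apply: ler_sum => w _; rewrite ler_wpM2l //; exact: ent_joint1.
rewrite -mulr_suml [leRHS]mulrA le_eqVlt; apply/orP; left; apply/eqP; congr (_ * _).
have -> : \sum_(w <- W) (#|` E| - count (fun h => w \in rtranslate E h) D)%:R =
  \sum_(w <- W) ((#|` E|%:R : R) - (count (fun h => w \in rtranslate E h) D)%:R).
  by apply: eq_bigr => w _; rewrite natrB.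
rewrite sumrB mulrBr; congr (_ - _).
  by rewrite big_const_seq count_predT iter_addr_0 mulr_natr.
rewrite -natrM -natr_sum; congr (_%:R).
under eq_bigr do rewrite -sum1_count big_mkcond.
rewrite exchange_big /= (eq_big_seq (fun=> #|` E|)).
  by rewrite big_const_seq count_predT iter_addn_0 mulnC.
move=> h hD; rewrite -big_mkcond sum1_count -(card_rtranslate E h) -size_filter.
apply/perm_size/uniq_perm; rewrite ?filter_uniq ?fset_uniq // => w.
rewrite mem_filter; apply: andb_idr; rewrite mem_rtranslate => wE.
by rewrite -(mulgVK h w) EDW.
Qed.

End GroupShearer.

(** * Entropy of an action as an infimum *)

Lemma card_fset_filter (K : choiceType) (A : {fset K}) (a : pred K) :
  #|` [fset x in A | a x]%fset| = count a A.
Proof.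
rewrite -size_filter; apply/perm_size/uniq_perm; rewrite ?filter_uniq ?fset_uniq //.
by move=> x; rewrite mem_filter !inE andbC.
Qed.

Lemma count_has_le (K L : Type) (s : seq K) (t : seq L) (a : L -> pred K) :
  (count (fun x => has (fun y => a y x) t) s <= \sum_(y <- t) count (a y) s)%N.
Proof.
elim: t => [|y t IH]; first by rewrite big_nil count_pred0.
rewrite big_cons; apply: leq_trans (leq_add (leqnn _) IH).
by rewrite -count_predUI leq_addr.
Qed.

Section InfimumRule.
Context (R : realType) d (X : measurableType d).
Variable mu : probability X R.
Variables (G : groupType) (act : G -> X -> X).
Hypothesis pmp : pmp_action mu act.

Definition orbit_label (J : finType) (f : X -> J) (g : G) (x : X) : J := f (act g x).

Definition mean_ent (J : finType) (f : X -> J) (F : {fset G}) : R :=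
  ent mu setT (joint (orbit_label f) F) / #|` F|%:R.

Definition inf_ent (J : finType) (f : X -> J) : R :=
  inf [set mean_ent f F | F in [set F : {fset G} | F != fset0]].

Section Labelling.
Variables (J : finType) (f : X -> J).
Hypothesis df : dmeas f.

Lemma dmeas_orbit_label g : dmeas (orbit_label f g).
Proof. exact: dmeas_transform (pmp_measurable pmp g) df. Qed.

Lemma mean_ent_ge0 F : 0 <= mean_ent f F.
Proof.
rewrite divr_ge0 // ent_ge0 //; apply: dmeas_joint; exact: dmeas_orbit_label.
Qed.

Lemma has_lbound_mean_ent :
  has_lbound [set mean_ent f F | F in [set F : {fset G} | F != fset0]].
Proof. by exists 0 => _ [F _ <-]; exact: mean_ent_ge0. Qed.

Lemma inf_ent_le F : F != fset0 -> inf_ent f <= mean_ent f F.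
Proof. by move=> F0; apply: ge_inf; [exact: has_lbound_mean_ent|exists F]. Qed.

Lemma inf_ent_adherent e : 0 < e -> exists2 F, F != fset0 & mean_ent f F < inf_ent f + e.
Proof.
move=> e0; have hi : has_inf [set mean_ent f F | F in [set F : {fset G} | F != fset0]].
  split; last exact: has_lbound_mean_ent.
  exists (mean_ent f [fset 1%g]%fset), [fset 1%g]%fset => //=.
  by apply/fset0Pn; exists 1%g; rewrite inE.
by have [_ [F F0 <-] Fe] := inf_adherent e0 hi; exists F.
Qed.

Lemma ent_joint_rtranslate E h :
  ent mu setT (joint (orbit_label f) (rtranslate E h)) =
  ent mu setT (joint (orbit_label f) E).
Proof.
have dj A : dmeas (joint (orbit_label f) A) := dmeas_joint dmeas_orbit_label A.
rewrite -(ent_transform (pmp_preserving pmp h) (dj E)); apply: ent_eq => //.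
- exact: dj.
- exact: dmeas_transform (pmp_measurable pmp h) (dj E).
- move=> x y _ _ /= /joint_eqP e; apply/joint_eqP => a; rewrite mem_rtranslate => aE.
  have := e _ aE; rewrite /orbit_label -!(pmp_actM pmp) mulgVK; exact.
- move=> x y _ _ /= /joint_eqP e; apply/joint_eqP => a aE.
  rewrite /orbit_label -!(pmp_actM pmp); apply: e.
  by rewrite mem_rtranslate mulgK.
Qed.

(** Shearer's inequality with [D] the set of all [h] in [F] such that [E h] is
    contained in [F]: the rest of [F] is small if [F] is almost invariant. *)
Lemma mean_ent_folner_bound (E F : {fset G}) : E != fset0 -> F != fset0 ->
  mean_ent f F <= mean_ent f E +
    (\sum_(e <- E) #|` fsym_diff (translate e F) F|%:R / #|` F|%:R) * ln #|J|%:R.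
Proof.
rewrite -!cardfs_gt0 -!(ltr0n R) => E0 F0.
pose D := [fset h in F | all (fun e => (e * h)%g \in F) E]%fset.
have DP e h : e \in E -> h \in D -> (e * h)%g \in F.
  by move=> eE; rewrite !inE => /andP[_ /allP]; exact.
have := group_shearer mu dmeas_orbit_label measurableT DP.
rewrite prT mul1r (eq_bigr (fun=> ent mu setT (joint (orbit_label f) E))); last first.
  by move=> h _; exact: ent_joint_rtranslate.
rewrite big_const_seq count_predT iter_addr_0 -[X in _ <= X + _]mulr_natr.
set hF := ent mu _ _; set hE := ent mu _ _ => hh.
have hE0 : 0 <= hE by apply: ent_ge0 => //; apply: dmeas_joint; exact: dmeas_orbit_label.
have DF : (#|` D| <= #|` F|)%N.
  by apply: fsubset_leq_card; apply/fsubsetP => x; rewrite !inE => /andP[].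
have lnJ : 0 <= ln #|J|%:R :> R.
  have [->|J0] := posnP #|J|; first by rewrite ln0.
  by rewrite ln_ge0 // ler1n.
have FD : #|` F|%:R - #|` D|%:R <= \sum_(e <- E) #|` fsym_diff (translate e F) F|%:R :> R.
  rewrite lerBlDr -natr_sum -natrD ler_nat card_fset_filter.
  rewrite -(count_predC (fun h => all (fun e => (e * h)%g \in F) E) F) addnC leq_add2r.
  rewrite (@eq_count _ _ (fun h => has (fun e => (e * h)%g \notin F) E)); last first.
    by move=> h /=; rewrite has_predC.
  apply: leq_trans (count_has_le _ _ _) _; apply: leq_sum => e _.
  rewrite -size_filter -(size_map (fun h => e * h)%g); apply: uniq_leq_size.
    by rewrite map_inj_uniq ?filter_uniq ?fset_uniq //; exact: mulgI.
  move=> x /mapP[h]; rewrite mem_filter => /andP[ehF hF0 ->].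
  by rewrite /fsym_diff inE; apply/orP; left; rewrite inE ehF translateE mulKg.
rewrite /mean_ent -/hF -/hE -mulr_suml mulrAC -ler_pdivlMr ?invr_gt0 // invrK.
set S := \sum_(e <- E) _ in FD *.
rewrite -mulrA mulrDl mulrAC -!mulrA mulVf ?gt_eqF // mulr1.
rewrite -(ler_pM2l E0); apply: le_trans hh _.
have -> : #|` E|%:R * (hE * (#|` F|%:R / #|` E|%:R) + S * ln #|J|%:R) =
    hE * #|` F|%:R + #|` E|%:R * (S * ln #|J|%:R) by field; rewrite gt_eqF.
apply: lerD.
  by rewrite ler_wpM2l // ler_nat.
by rewrite ler_wpM2l ?(ltW E0) // ler_wpM2r.
Qed.

Lemma mean_ent_cvg (F : nat -> {fset G}) : folner_sequence R F ->
  (fun n => mean_ent f (F n)) @ \oo --> inf_ent f.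
Proof.
move=> [F0 Ffol].
apply/cvgrPdist_le => e e0; have e2 : 0 < e / 2 by rewrite divr_gt0.
have [E E0 hE] := inf_ent_adherent e2.
have sum0 : (fun n => (\sum_(g <- E)
    #|` fsym_diff (translate g (F n)) (F n)|%:R / #|` F n|%:R) * ln #|J|%:R : R) @ \oo --> (0 : R).
  rewrite -[X in _ --> X](mul0r (ln #|J|%:R)); apply: cvgMl.
  elim: (E : seq G) => [|g s IH].
    by under eq_fun do rewrite big_nil; exact: cvg_cst.
  under eq_fun do rewrite big_cons.
  by have := cvgD (Ffol g) IH; rewrite addr0; exact.
have /cvgrPdist_le/(_ _ e2) := sum0; apply: filterS => n.
rewrite sub0r normrN => /ler_normlW hn.
have h1 := inf_ent_le (F0 n).
have h2 := mean_ent_folner_bound E0 (F0 n).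
rewrite distrC ger0_norm ?subr_ge0 //; lra.
Qed.

End Labelling.

Lemma shannon_entropy_fin (T : finType) (f : X -> T) (P : T -> set X) :
  dmeas f -> (forall t, P t = f @^-1` [set t]) ->
  shannon_entropy mu P = (ent mu setT f)%:E.
Proof.
move=> df PE; rewrite /shannon_entropy /ent prT eta1 subr0 /ent_law.
rewrite -sumEFin esum_fset //=; last first.
  move=> t _; rewrite lee_fin -/(eta _) eta_ge0 // pr_le1 // PE; exact: df.2.
rewrite (fsbigTE [fset t | t in T]%fset) => [|t]; last by rewrite !inE.
rewrite -[RHS]big_enum (perm_big (enum T)) /=; last first.
  apply: uniq_perm; rewrite ?enum_uniq ?fset_uniq // => t.
  by rewrite mem_enum !inE.
by apply: eq_bigr => t _; rewrite /law setTI PE.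
Qed.

Section EntropyPartition.
Hypothesis folner_ex : exists F : nat -> {fset G}, folner_sequence R F.
Variables (k : nat) (P : 'I_k -> set X) (f : X -> 'I_k).
Hypothesis df : dmeas f.
Hypothesis PE : forall i, P i = f @^-1` [set i].

(** A Folner sequence exists, so the limit in the definition of the entropy is
    unique, and the choice operator returns it. *)
Lemma entropy_partitionE : entropy_partition mu act P = (inf_ent f)%:E.
Proof.
have avgE F : average_entropy mu act P F = (mean_ent f F)%:E.
  rewrite /average_entropy (@shannon_entropy_fin _ (joint (orbit_label f) F)).
  - by rewrite -EFinM mulrC.
  - by apply: dmeas_joint; exact: dmeas_orbit_label.
  move=> w; rewrite /join_partition eqEsubset; split=> x /= h.
    apply/ffunP => g; rewrite ffunE; have := h g I.
    by rewrite PE.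
  by move=> g _ /=; rewrite PE /= -h ffunE.
apply: xget_unique => /=.
  move=> F Ff; under eq_fun do rewrite avgE.
  by apply: cvg_EFin; [exact: nearW|exact: mean_ent_cvg].
move=> h hP; have [F Ff] := folner_ex.
have := hP _ Ff; under eq_fun do rewrite avgE.
move=> /(cvg_lim (@ereal_hausdorff R)) <-; apply: (cvg_lim (@ereal_hausdorff R)).
by apply: cvg_EFin; [exact: nearW|exact: mean_ent_cvg].
Qed.

End EntropyPartition.
End InfimumRule.

(** * Describable random variables *)

Lemma sum_option (V : nmodType) (T : finType) (F : option T -> V) :
  \sum_o F o = F None + \sum_t F (Some t).
Proof.
rewrite (bigD1 None) //=; congr (_ + _).
rewrite (reindex_omap Some id) /=; last by case.
by apply: eq_bigl => t; rewrite /= eqxx.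
Qed.

Section Describable.
Context (R : realType) d (X : measurableType d).
Variable mu : probability X R.

Lemma pr_setU_le A B : measurable A -> measurable B ->
  pr mu (A `|` B) <= pr mu A + pr mu B.
Proof.
move=> mA mB; rewrite -lee_fin EFinD -!prE //; last exact: measurableU.
exact: measureU2.
Qed.

Lemma prob_inhabited : inhabited X.
Proof.
apply: contrapT => h; have := prT mu; rewrite (_ : setT = set0) ?pr0.
  by move/eqP; rewrite eq_sym oner_eq0.
by rewrite -subset0 => x; case: h.
Qed.

(** Entropy at most [c] for maps into an arbitrary type: outside an event of small
    probability the value can be decoded from a finite-valued variable of entropy
    at most [c]. In this way countable alphabets only need finite entropy sums,
    and changes on null sets do not matter. *)
Definition describable (S : Type) (c : R) (f : X -> S) : Prop :=
  forall e : R, 0 < e -> exists (T : finType) (Z : X -> T) (dec : T -> S) (N : set X),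
    [/\ dmeas Z, measurable N, pr mu N <= e, ent mu setT Z <= c &
        forall x, ~ N x -> dec (Z x) = f x].

Lemma desc_mono S (f : X -> S) c c' : c <= c' -> describable c f -> describable c' f.
Proof.
move=> cc' df e /df[T [Z [dec [N [dZ mN Ne Zc decP]]]]].
by exists T, Z, dec, N; split=> //; exact: le_trans cc'.
Qed.

Lemma desc_comp S S' (F : S -> S') (f : X -> S) c :
  describable c f -> describable c (F \o f).
Proof.
move=> df e /df[T [Z [dec [N [dZ mN Ne Zc decP]]]]].
by exists T, Z, (F \o dec), N; split=> // x /decP /= ->.
Qed.

Lemma desc_fin (T : finType) (f : X -> T) c :
  dmeas f -> ent mu setT f <= c -> describable c f.
Proof.
move=> df fc e e0; exists T, f, id, set0; split=> //; by rewrite pr0 ltW.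
Qed.

Lemma desc_card (T : finType) (f : X -> T) : dmeas f -> describable (ln #|T|%:R) f.
Proof.
move=> df; apply: desc_fin => //; apply: le_trans (ent_le_card mu measurableT df) _.
by rewrite prT mul1r.
Qed.

Lemma desc_pair S S' (f : X -> S) (g : X -> S') c c' :
  describable c f -> describable c' g -> describable (c + c') (fun x => (f x, g x)).
Proof.
move=> df dg e e0; have e2 : 0 < e / 2 by rewrite divr_gt0.
have [T [Z [dec [N [dZ mN Ne Zc decP]]]]] := df _ e2.
have [T' [Z' [dec' [N' [dZ' mN' Ne' Zc' decP']]]]] := dg _ e2.
exists (T * T')%type, (fun x => (Z x, Z' x)), (fun z => (dec z.1, dec' z.2)), (N `|` N').
split; first exact: dmeas_pair.
- exact: measurableU.
- by apply: le_trans (pr_setU_le mN mN') _; lra.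
- by apply: le_trans (ent_pair_le mu measurableT dZ dZ') _; exact: lerD.
- by move=> x /not_orP[/decP-> /decP'->].
Qed.

Lemma desc_cst S (s : S) : describable 0 (fun=> s).
Proof.
apply: (@desc_comp _ _ (fun=> s) (fun=> tt)); apply: desc_fin.
  exact: dmeas_cst.
by rewrite ent_const.
Qed.

Lemma desc_transform S (f : X -> S) c (a : X -> X) :
  measurable_fun setT a -> (forall A, measurable A -> mu (a @^-1` A) = mu A) ->
  describable c f -> describable c (f \o a).
Proof.
move=> ma pa df e /df[T [Z [dec [N [dZ mN Ne Zc decP]]]]].
exists T, (Z \o a), dec, (a @^-1` N); split.
- exact: dmeas_transform.
- by rewrite -[X in measurable X]setTI; exact: ma.
- by rewrite /pr pa.
- by rewrite ent_transform.
- by move=> x /decP.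
Qed.

Lemma pr_conullC A : measurable A -> mu A = 1%E -> pr mu (~` A) = 0.
Proof. by move=> mA A1; rewrite prC // /pr A1 subrr. Qed.

Lemma desc_ae S (f g : X -> S) c A : measurable A -> mu A = 1%E ->
  (forall x, A x -> f x = g x) -> describable c f -> describable c g.
Proof.
move=> mA A1 fg df e /df[T [Z [dec [N [dZ mN Ne Zc decP]]]]].
have mU : measurable (N `|` ~` A) by apply: measurableU => //; exact: measurableC.
exists T, Z, dec, (N `|` ~` A); split=> //.
- apply: le_trans (pr_setU_le mN (measurableC mA)) _.
  by rewrite pr_conullC // addr0.
- by move=> x /not_orP[/decP-> /contrapT/fg].
Qed.

(** A countable range is exhausted by finite sets, whose preimages have measure
    tending to [1]. *)
Lemma dmeas_tail (S : choiceType) (f : X -> S) (e : R) : dmeas f -> 0 < e ->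
  exists S0 : {fset S}, forall S1 : {fset S}, (S0 `<=` S1)%fset ->
    pr mu (f @^-1` [set s | s \notin S1]) <= e.
Proof.
move=> df e0; have /countable_injP[i inj] := df.1.
pose A n := f @^-1` [set s | (i s < n)%N].
have mA n : measurable (A n) by exact: dmeas_preimage.
have /cvgrPdist_le/(_ _ e0) : (fun n => pr mu (A n)) @ \oo --> (1 : R).
  have AT : \bigcup_n A n = setT.
    by rewrite -subTset => x _; exists (i (f x)).+1 => //=; rewrite /A /= ltnSn.
  have h : mu \o A @ \oo --> mu (\bigcup_n A n).
    apply: nondecreasing_cvg_mu => //; first by rewrite AT.
    by move=> m n mn; apply/subsetPset => x; rewrite /A /= => h; exact: leq_trans h mn.
  rewrite AT probability_setT in h.
  by have /fine_cvgP[_] := h; exact.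
move=> [n _ /(_ n (leqnn n))]; rewrite /= => hn.
have [x0] := prob_inhabited.
pose s_ m := xget (f x0) [set s | range f s /\ i s = m].
exists [fset s_ m | m in iota 0 n]%fset => S1 /fsubsetP S01.
apply: le_trans (_ : pr mu (~` A n) <= _); last first.
  rewrite prC //; apply: le_trans hn; exact: ler_norm.
apply: pr_mono; [exact: dmeas_preimage|exact: measurableC|].
move=> x /= /negP fS1 /= Anx; apply/fS1/S01/imfsetP.
exists (i (f x)); first by rewrite mem_iota add0n.
rewrite /s_; apply/esym; case: xgetP => [y -> [ry iy]|/(_ (f x))[]].
  by apply: inj => //; rewrite inE //; exists x.
by split=> //; exists x.
Qed.

(** The tail of a convergent entropy series is small. The symbol [None], which
    stands for all frequent values, has probability close to [1] and thus
    contributes little as well. *)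
Lemma shannon_tail (S : choiceType) (f : X -> S) (e : R) : dmeas f -> 0 < e ->
  (shannon_entropy mu (fun s => f @^-1` [set s]) < +oo)%E ->
  exists S0 : {fset S}, forall S1 : {fset S}, (S0 `<=` S1)%fset ->
    pr mu (f @^-1` [set s | s \notin S1]) <= e /\
    describable e (fun x => if f x \in S1 then None else Some (f x)).
Proof.
move=> df e0 finH; have e2 : 0 < e / 2 by rewrite divr_gt0.
pose a s := eta (pr mu (f @^-1` [set s])).
have a0 s : 0 <= a s by apply/eta_ge0/pr_le1; exact: df.2.
have [S0 S0P] : exists S0 : {fset S}, forall S1 : {fset S}, (S0 `<=` S1)%fset ->
    \sum_(s <- S1) a s - \sum_(s <- S0) a s <= e / 2.
  have hsum (D : {fset S}) : ((\sum_(s <- D) a s)%:E <=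
      shannon_entropy mu (fun s => f @^-1` [set s]))%E.
    apply: esum_ge; exists [set` D] => //.
    by rewrite -sumEFin fsbig_seq ?fset_uniq.
  have := finH; have : (shannon_entropy mu (fun s => f @^-1` [set s]) \is a fin_num).
    rewrite ge0_fin_numE //; apply: esum_ge0 => s _; rewrite lee_fin; exact: a0.
  move=> fin _.
  have [x [D [finD _] xE] xD] := ub_ereal_sup_adherent e2 fin.
  have [D' DE] := (finite_fsetP.1 finD); exists D' => S1 _.
  have := hsum S1; rewrite -(fineK fin) lee_fin => h1.
  move: xD; rewrite -xE DE -fsbig_seq ?fset_uniq // sumEFin.
  rewrite -[ereal_sup _](fineK fin) -EFinB lte_fin => h2.
  move: h1 h2; rewrite /a; lra.
have [S2 S2P] := dmeas_tail df e2.
exists (S0 `|` S2)%fset => S1 /fsubsetP S1P.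
have pS1 : pr mu (f @^-1` [set s | s \notin S1]) <= e / 2.
  by apply: S2P; apply/fsubsetP => s s2; apply: S1P; rewrite inE s2 orbT.
split; first by apply: le_trans pS1 _; lra.
move=> de de0; have [S3 S3P] := dmeas_tail df de0.
pose S' := (S1 `|` S3)%fset.
pose Z x : option S' := if f x \in S1 then None else insub (f x).
have dZ : dmeas Z by exact: (dmeas_comp (fun s => if s \in S1 then None else insub s)).
exists (option S'), Z, (omap val), (f @^-1` [set s | s \notin S']); split=> //.
- exact: dmeas_preimage.
- by apply: S3P; exact: fsubsetUr.
- rewrite /ent prT eta1 subr0 /ent_law sum_option /=.
  have -> : e = e / 2 + e / 2 by lra.
  apply: lerD.
    apply: le_trans (eta_le_subr (law_ge0 _ _ _ _)) _.
    apply: le_trans pS1; rewrite /law setTI lerBlDl -lerBlDr -prC; last exact: dmeas_preimage.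
    apply: pr_mono; [exact/measurableC/dmeas_preimage|exact: dZ.2|].
    by move=> x /= /negP; rewrite negbK /Z => ->.
  have S01 : (S0 `<=` S')%fset.
    by apply/fsubsetP => s s0; rewrite inE S1P // inE s0.
  apply: le_trans (S0P _ S01); rewrite lerBrDl.
  rewrite [leRHS](bigID (mem S0)) /= -[X in _ <= X + _]big_filter.
  rewrite [X in _ <= X + _](perm_big (S0 : seq S)) /=; last first.
    apply: uniq_perm; rewrite ?filter_uniq ?fset_uniq // => s.
    rewrite mem_filter /=; apply: andb_idr => s0; exact: (fsubsetP S01).
  rewrite lerD2l [leRHS]big_mkcond big_seq_fsetE /=; apply: ler_sum => u _.
  case: ifPn => [uS0|uS0].
    have [uS1|uS1] := boolP (val u \in S1); last first.
      rewrite /a le_eqVlt; apply/orP; left; apply/eqP; congr eta.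
      rewrite /law setTI; congr (pr mu _); rewrite eqEsubset; split=> x /=.
        by rewrite /Z; case: ifP => // _; case: insubP => // v _ <- [->].
      by rewrite /Z => ->; rewrite (negbTE uS1) valK.
    rewrite (_ : law _ _ _ _ = 0) ?eta0 // /law setTI -[RHS](pr0 mu); congr (pr mu _).
    rewrite -subset0 => x /=; rewrite /Z; case: ifP => // fS1.
    by case: insubP => // v _ vf [vu]; rewrite -vu vf fS1 in uS1.
  rewrite negbK in uS0.
  rewrite (_ : law _ _ _ _ = 0) ?eta0 // /law setTI -[RHS](pr0 mu); congr (pr mu _).
  rewrite -subset0 => x /=; rewrite /Z; case: ifP => // fS1.
  by case: insubP => // v _ vf [vu]; rewrite -vu vf in uS0; rewrite S1P ?inE ?uS0 in fS1.
- move=> x /= /negP; rewrite negbK /Z => fS'; case: ifP => // _.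
  by rewrite insubT.
Qed.

End Describable.

(** * Sublinear entropy of Shannon cocycles *)

Section RareSymbols.
Context (R : realType) d (X : measurableType d).
Variable mu : probability X R.

(** The bounds used are [1 - x] for the symbol [None] and [2 sqrt x] for the others. *)
Lemma ent_rare (T : finType) (Z : X -> option T) (p : R) : dmeas Z ->
  pr mu (Z @^-1` [set z | z != None]) <= p ->
  ent mu setT Z <= p + #|T|%:R * (2 * Num.sqrt p).
Proof.
move=> dZ hp; rewrite /ent prT eta1 subr0 /ent_law sum_option; apply: lerD.
  apply: le_trans (eta_le_subr (law_ge0 _ _ _ _)) _; apply: le_trans hp.
  rewrite /law setTI lerBlDl -lerBlDr -prC; last exact: dmeas_preimage.
  apply: pr_mono; [exact/measurableC/dmeas_preimage|exact: dZ.2|].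
  by move=> x /= /negP; rewrite negbK => /eqP.
rewrite mulr_natl -sumr_const; apply: ler_sum => t _.
apply: le_trans (eta_le_sqrt (law_ge0 _ _ _ _)) _; rewrite ler_pM2l //.
have p0 : 0 <= p by apply: le_trans hp; exact: pr_ge0.
rewrite ler_sqrt //; apply: le_trans hp; rewrite /law setTI.
apply: pr_mono; [exact: dZ.2|exact: dmeas_preimage|].
by move=> x /= ->.
Qed.

Lemma ent_rare_small (c : nat) (e : R) : 0 < e ->
  exists2 p : R, 0 < p & p + c%:R * (2 * Num.sqrt p) <= e.
Proof.
move=> e0; pose s := Num.min 1 (e / (c%:R * 2 + 1)).
have c1 : 0 < c%:R * 2 + 1 :> R by rewrite ltr_wpDl // mulr_ge0.
have s0 : 0 < s by rewrite lt_min ltr01 divr_gt0.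
have s1 : s <= 1 by rewrite ge_min lexx.
have se : s * (c%:R * 2 + 1) <= e by rewrite -ler_pdivlMr // ge_min lexx orbT.
exists (s ^+ 2); first by rewrite exprn_gt0.
rewrite sqrtr_sqr ger0_norm ?(ltW s0) //; apply: le_trans se.
move: (c%:R : R) (ler0n R c) => z z0; nra.
Qed.

End RareSymbols.

Section Cocycle.
Context (R : realType) d (X : measurableType d).
Variable mu : probability X R.
Variables (G H : groupType) (act : G -> X -> X).
Hypothesis pmp : pmp_action mu act.
Variables (X1 : set X) (kappa : G -> X -> H).
Hypothesis mX1 : measurable X1.
Hypothesis conullX1 : mu X1 = 1%E.
Hypothesis invX1 : forall g x, X1 x -> X1 (act g x).
Hypothesis dkappa : forall g, dmeas (kappa g).
Hypothesis kappaM : forall g h x, X1 x ->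
  kappa (g * h)%g x = (kappa g (act h x) * kappa h x)%g.

Lemma kappa1 x : X1 x -> kappa 1%g x = 1%g.
Proof.
move=> Xx; have := kappaM 1%g 1%g Xx; rewrite mulg1 (pmp_act1 pmp).
by move=> h; apply: (@mulIg _ (kappa 1%g x)); rewrite mul1g -h.
Qed.

Section Words.
Variables (A : {pred H}) (ts : seq H).
Hypothesis Agrp : group_closed A.
Hypothesis Acomm : {in A &, forall a b, commute a b}.
Hypothesis ts_cover : forall g, exists2 t, t \in ts & (t^-1 * g)%g \in A.
Variable gens : seq G.

Local Notation rep := (coset_rep ts_cover).

Variables (L : {fset H}) (delta : R).
Hypothesis tail_desc : forall s, s \in letters gens ->
  describable mu delta (fun x => if kappa s x \in L then None else Some (kappa s x)).
Hypothesis coset_desc : forall s, s \in letters gens ->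
  forall r r' : X -> seq_sub ts, dmeas r -> dmeas r' -> forall g,
  describable mu delta
    (fun x => if kappa s (act g x) \in L then None else Some (r x, r' x)).

(** Induction on the word with [coset_step]: the factors from letters with value
    in [L] are counted by [c], the other ones are collected in [tl], for which the
    letter and two cosets must be described at these rare times. *)
Lemma cocycle_word n u : u \in wball gens n ->
  exists (tl : X -> H) (c : H -> X -> nat),
  [/\ describable mu (2 * delta * n%:R) tl,
      forall y, dmeas (c y),
      forall y x, (c y x <= n)%N &
      forall x, X1 x -> tl x \in A /\
        kappa u x = (rep (kappa u x)
          * (tl x * prod_powers (coset_steps A ts L) (fun y => c y x))
          * (rep 1)^-1)%g].
Proof.
set Y := coset_steps A ts L; have YA : {subset Y <= A} by exact: coset_stepsA.
elim: n u => [|n IH] u.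
  rewrite wball0 inE => /eqP->; exists (fun=> 1%g), (fun _ _ => 0%N); split=> //.
  - by rewrite mulr0; exact: desc_cst.
  - by move=> y; exact: dmeas_cst.
  - move=> x Xx; rewrite (proj1 Agrp) kappa1 // mul1g; split=> //.
    by rewrite /prod_powers big1 ?mulg1 ?mulgV // => y _; rewrite expg0.
move=> /wballSP[s sl [u' /IH[tl [c [dtl dc cn tlP]]] ->]].
pose srep h : seq_sub ts := SeqSub (coset_rep_in ts_cover h).
pose h x := kappa s (act u' x); pose r x := srep (kappa u' x).
pose r' x := srep (kappa (s * u')%g x).
have dh : dmeas h by exact: dmeas_transform (pmp_measurable pmp u') (dkappa s).
have dr : dmeas r by exact: dmeas_comp (dkappa u').
have dr' : dmeas r' by exact: dmeas_comp (dkappa _).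
pose y x := ((val (r' x))^-1 * h x * val (r x))%g.
have dy : dmeas y.
  exact: (dmeas_comp (fun z : (seq_sub ts * H * seq_sub ts)%type =>
     ((val z.1.1)^-1 * z.1.2 * val z.2)%g) (dmeas_pair (dmeas_pair dr' dh) dr)).
exists (fun x => if h x \in L then tl x else (y x * tl x)%g).
exists (fun z x => ((h x \in L) && (z == y x)) + c z x)%N; split.
- pose F (z : (option H * option (seq_sub ts * seq_sub ts) * H)%type) : H :=
    if z.1.1 is Some k then
      if z.1.2 is Some (p, q) then ((val q)^-1 * k * val p * z.2)%g else z.2
    else z.2.
  have := desc_comp F (desc_pair (desc_pair
    (desc_transform (pmp_measurable pmp u') (pmp_preserving pmp u') (tail_desc sl))
    (coset_desc sl dr dr' u')) dtl).
  have -> : 2 * delta * n.+1%:R = delta + delta + 2 * delta * n%:R.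
    by rewrite -[n.+1%:R]natr1; ring.
  congr describable; apply/funext => x; rewrite /F /=.
  by rewrite /h; case: ifP.
- move=> z.
  exact: (dmeas_comp (fun w : (H * H * nat)%type =>
     (((w.1.1 \in L) && (z == w.1.2)) + w.2)%N)
     (dmeas_pair (dmeas_pair dh dy) (dc z))).
- move=> z x; by rewrite -add1n leq_add // leq_b1.
move=> x Xx; have [tlA kE] := tlP x Xx.
have bA : (tl x * prod_powers Y (fun y => c y x))%g \in A.
  by rewrite (group_closedM Agrp) // prod_powersA.
have := coset_step Agrp (h x) bA kE; rewrite -[(h x * _)%g]kappaM //.
rewrite -/(y x) => -[yA Ek].
have [hL|hL] := boolP (h x \in L).
  split=> //; rewrite {1}Ek; congr (_ * _ * _)%g.
  rewrite mulgA (Acomm yA tlA) -mulgA; congr (_ * _)%g.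
  apply: (prod_powers_incr Agrp Acomm (fun z => c z x) YA) => //.
    exact: coset_steps_uniq.
  rewrite /y /= kappaM //; apply: mem_coset_steps => //.
  by rewrite -kappaM.
split; first by rewrite (group_closedM Agrp).
by rewrite {1}Ek; congr (_ * _ * _)%g; rewrite mulgA.
Qed.

(** The counters take at most [n.+1] values each, which costs only [O(ln n)]. *)
Lemma cocycle_word_desc n u : u \in wball gens n ->
  describable mu (ln (#|{: seq_sub ts}|%:R : R) + 2 * delta * n%:R +
    #|{: seq_sub (coset_steps A ts L)}|%:R * ln n.+1%:R) (kappa u).
Proof.
move=> /cocycle_word[tl [c [dtl dc cn tlP]]].
set Y := coset_steps A ts L in tlP *.
pose srep x : seq_sub ts := SeqSub (coset_rep_in ts_cover (kappa u x)).
have dsrep : dmeas srep.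
  exact: (dmeas_comp (fun h => SeqSub (coset_rep_in ts_cover h)) (dkappa u)).
pose C x : {ffun seq_sub Y -> 'I_n.+1} := [ffun y => inord (c (val y) x)].
have dC : dmeas C by apply: dmeas_ffun => y; exact: (dmeas_comp inord (dc _)).
pose F (z : (seq_sub ts * H * {ffun seq_sub Y -> 'I_n.+1})%type) : H :=
  (val z.1.1 * (z.1.2 * prod_powers Y
     (fun y => if insub y is Some v then val (z.2 v) else 0%N)) * (rep 1)^-1)%g.
have := desc_comp F (desc_pair (desc_pair (desc_card mu dsrep) dtl) (desc_card mu dC)).
have -> : ln (#|{ffun seq_sub Y -> 'I_n.+1}|%:R : R) =
    #|{: seq_sub Y}|%:R * ln n.+1%:R.
  by rewrite card_ffun card_ord natrX lnXn ?ltr0n // [RHS]mulr_natl.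
apply: (desc_ae mX1 conullX1) => x Xx; have [_ ->] := tlP x Xx.
rewrite /F /=; congr (_ * (_ * _) * _)%g; apply: eq_big_seq => y yY.
case: insubP => [v _ vy|]; last by rewrite yY.
by rewrite ffunE vy inordK // ltnS.
Qed.

End Words.

(** With [L] large, the letters outside [L] cost little: their values by
    finiteness of the Shannon entropy, the cosets since they are only recorded at
    rare times. *)
Theorem cocycle_sublinear (gens : seq G) :
  virtually_abelian H -> shannon_cocycle mu kappa ->
  forall e : R, 0 < e -> exists N : nat, forall n, (N <= n)%N ->
  forall u, u \in wball gens n -> describable mu (e * n%:R) (kappa u).
Proof.
move=> [A [Agrp Acomm [ts ts_cover]]] sh e e0.
(* Of the budget [e n], half pays for the rare letters, and a quarter each for
   the coset and for the counters. *)
pose delta := e / 4; have delta0 : 0 < delta by rewrite divr_gt0.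
have [p p0 hp] := ent_rare_small #|{: seq_sub ts * seq_sub ts}| delta0.
pose p' := Num.min p delta; have p'0 : 0 < p' by rewrite lt_min p0.
pose T s : {fset H} := sval (cid (shannon_tail (dkappa s) p'0 (sh s))).
have TP s S1 : (T s `<=` S1)%fset ->
    pr mu (kappa s @^-1` [set h | h \notin S1]) <= p' /\
    describable mu p' (fun x => if kappa s x \in S1 then None else Some (kappa s x)).
  by rewrite /T; case: cid => ? h; exact: h.
pose L := (\bigcup_(s <- letters gens) T s)%fset.
have TL s : s \in letters gens -> (T s `<=` L)%fset by move=> sl; exact: bigfcup_sup.
have tail_desc s : s \in letters gens ->
  describable mu delta (fun x => if kappa s x \in L then None else Some (kappa s x)).
  by move=> /TL /TP[_]; apply: desc_mono; rewrite ge_min lexx orbT.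
have coset_desc s : s \in letters gens ->
  forall r r' : X -> seq_sub ts, dmeas r -> dmeas r' -> forall g,
  describable mu delta
    (fun x => if kappa s (act g x) \in L then None else Some (r x, r' x)).
  move=> sl r r' dr dr' g.
  have dk : dmeas (fun x => kappa s (act g x)).
    exact: dmeas_transform (pmp_measurable pmp g) (dkappa s).
  have dZ : dmeas (fun x => if kappa s (act g x) \in L then None else Some (r x, r' x)).
    exact: (dmeas_comp (fun z : (H * (seq_sub ts * seq_sub ts))%type =>
      if z.1 \in L then None else Some z.2) (dmeas_pair dk (dmeas_pair dr dr'))).
  apply: desc_fin => //; apply: le_trans hp; apply: ent_rare => //.
  have [h _] := TP _ _ (TL _ sl); apply: le_trans (_ : p' <= _); last first.
    by rewrite ge_min lexx.
  apply: le_trans h; rewrite /pr -(pmp_preserving pmp g (A := kappa s @^-1` _)).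
    rewrite le_eqVlt; apply/orP; left; apply/eqP; congr (fine (mu _)).
    by rewrite eqEsubset; split=> x /=; case: (kappa s (act g x) \in L).
  exact: dmeas_preimage.
set q := #|{: seq_sub (coset_steps A ts L)}|.
have eq0 : 0 < e / 4 / q.+1%:R by rewrite !divr_gt0.
have [N1 HN1] := ln_sublin eq0.
have [N2 HN2] := exists_nat_ge (ln (#|{: seq_sub ts}|%:R : R) / (e / 4)).
exists (maxn N1 N2) => n; rewrite geq_max => /andP[n1 n2] u un.
apply: (desc_mono _ (cocycle_word_desc Agrp Acomm ts_cover tail_desc coset_desc un)).
have h1 : ln (#|{: seq_sub ts}|%:R : R) <= e / 4 * n%:R.
  rewrite mulrC -ler_pdivrMr ?divr_gt0 //; apply: le_trans HN2 _.
  by rewrite ler_nat.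
have h2 : q%:R * ln n.+1%:R <= e / 4 * n%:R.
  apply: le_trans (_ : q.+1%:R * (e / 4 / q.+1%:R * n%:R) <= _).
    apply: ler_pM; rewrite ?ler0n ?ler_nat ?HN1 //.
    by rewrite ln_ge0 // ler1n.
  by rewrite mulrA mulrCA mulfV ?mulr1 // pnatr_eq0.
move: h1 h2; rewrite -/q /delta; lra.
Qed.

End Cocycle.

(** * Nets in word balls *)

Section Nets.
Variables (G : groupType) (gens : seq G).
Local Notation wball := (wball gens).

(** Equivalently, the sets [wball r * v] for [v] in [V] are pairwise disjoint. *)
Definition spread_out (r : nat) (V : {fset G}) : Prop :=
  {in V &, forall v w, (v * w^-1)%g \in wball (r + r) -> v = w}.

(** [V] is a maximal spread out subset of [A]. *)
Lemma exists_net (r : nat) (A : {fset G}) : exists (V : {fset G}) (pi : G -> G),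
  [/\ spread_out r V, (V `<=` A)%fset,
      {in A, forall a, pi a \in V} &
      {in A, forall a, (a * (pi a)^-1)%g \in wball (r + r)}].
Proof.
suff [V [sV VA netV]] : exists V : {fset G}, [/\ spread_out r V, {subset V <= A} &
    {in A, forall a, exists2 v, v \in V & (a * v^-1)%g \in wball (r + r)}].
  exists V, (fun a => xget 1%g [set v | v \in V /\ (a * v^-1)%g \in wball (r + r)]).
  split=> //; first exact/fsubsetP.
    by move=> a /netV[v vV av]; case: xgetP => [w _ []//|/(_ v)[]].
  by move=> a /netV[v vV av]; case: xgetP => [w _ []//|/(_ v)[]].
suff H (s : seq G) : exists V : {fset G}, [/\ spread_out r V, {subset V <= s} &
    {in s, forall a, exists2 v, v \in V & (a * v^-1)%g \in wball (r + r)}].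
  by have [V [h1 h2 h3]] := H A; exists V.
elim: s => [|a s [V [sV Vs netV]]]; first by exists fset0; split=> // v w; rewrite inE.
have [[v vV av]|noV] := pselect (exists2 v, v \in V & (a * v^-1)%g \in wball (r + r)).
  exists V; split=> // [w /Vs ws|b]; first by rewrite inE ws orbT.
  by rewrite inE => /orP[/eqP->|/netV//]; exists v.
exists (a |` V)%fset; split.
- move=> v w; rewrite !inE => /orP[/eqP->|vV] /orP[/eqP->|wV] //.
  + by move=> aw; case: noV; exists w.
  + move=> va; case: noV; exists v => //.
    by rewrite -[(a * v^-1)%g]invgK invgM invgK wballV.
  + exact: sV.
- by move=> v; rewrite !inE => /orP[->//|/Vs->]; rewrite orbT.
- move=> b; rewrite inE => /orP[/eqP->|/netV[v vV bv]].
    by exists a; rewrite ?fset1U1 // mulgV wball1.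
  by exists v => //; rewrite inE vV orbT.
Qed.

Lemma card_spread_out r (V U : {fset G}) : spread_out r V ->
  (forall t v, t \in wball r -> v \in V -> (t * v)%g \in U) ->
  (#|` V| * #|` wball r| <= #|` U|)%N.
Proof.
move=> sV VU; rewrite mulnC.
have := @uniq_leq_size _ [seq (t * v)%g | t <- wball r, v <- V] U.
rewrite size_allpairs; apply; last by move=> _ /allpairsP[[t v] [/= tr vV ->]]; exact: VU.
apply: allpairs_uniq; rewrite ?fset_uniq // => -[t v] [t' v'] /=.
move=> /allpairsP[[t0 v0] [/= tr vV [-> ->]]] /allpairsP[[t1 v1] [/= tr' vV' [-> ->]]] e.
have vv : v0 = v1.
  apply: sV => //; have -> : (v0 * v1^-1 = t0^-1 * t1)%g.
    by rewrite -(mulKg t0 v0) e -!mulgA mulgV mulg1.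
  by apply: wballM => //; exact: wballV.
by move: e; rewrite vv => /mulIg->.
Qed.

End Nets.

Section NetDescription.
Context (R : realType) d (X : measurableType d).
Variable mu : probability X R.
Variables (G H : groupType) (act : G -> X -> X).
Hypothesis pmp : pmp_action mu act.
Variables (X1 : set X) (kappa : G -> X -> H).
Hypothesis mX1 : measurable X1.
Hypothesis conullX1 : mu X1 = 1%E.
Hypothesis kappaM : forall g h x, X1 x ->
  kappa (g * h)%g x = (kappa g (act h x) * kappa h x)%g.
Variable gens : seq G.
Local Notation wball := (wball gens).

(** The family of the [kappa g x], [g] in [W], is padded with [1] to a map on [G],
    so that its type is the same for all [W]. *)
Definition restrict_cocycle (W : {fset G}) (x : X) (g : G) : H :=
  if g \in W then kappa g x else 1%g.

Variables (r : nat) (c : R).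
Hypothesis c0 : 0 <= c.
Hypothesis kappa_desc : forall u, u \in wball (r + r + 1 + (r + r)) ->
  describable mu c (kappa u).

(** Once [kappa w x] is known, the cocycle identity reduces [kappa v x] to the
    value of [kappa (v * w^-1)] at [w x], which has the same cost as at [x]. *)
Lemma desc_add_seq (W : {fset G}) (s : seq G) :
  {in s, forall v, exists2 w, w \in W & (v * w^-1)%g \in wball (r + r + 1 + (r + r))} ->
  describable mu (c * #|` W|%:R) (restrict_cocycle W) ->
  let W' := (W `|` [fset v in s])%fset in
  describable mu (c * #|` W'|%:R) (restrict_cocycle W').
Proof.
move=> sW dW; elim: s sW => [|v s IH] sW /=.
  by rewrite (_ : (W `|` _)%fset = W) //; apply/fsetP => x; rewrite !inE orbF.
have {}IH := IH (fun x xs => sW x (@mem_behead _ (v :: s) x xs)).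
set W' := (W `|` [fset v in s])%fset in IH.
have -> : (W `|` [fset v0 in v :: s] = v |` W')%fset.
  by apply/fsetP => x; rewrite !inE orbCA.
have [vW'|vW'] := boolP (v \in W').
  by rewrite (_ : (v |` W')%fset = W') //; apply/fsetP => x; rewrite in_fset1U; case: eqP => [->|].
have [w wW vw] := sW v (mem_head _ _).
have wW' : w \in W' by rewrite inE wW.
rewrite cardfsU1 vW' natrD mulrDr mulr1 addrC /=.
pose F (z : (G -> H) * H) : G -> H := fun g => if g == v then (z.2 * z.1 w)%g else z.1 g.
have := desc_comp F (desc_pair IH
   (desc_transform (pmp_measurable pmp w) (pmp_preserving pmp w) (kappa_desc vw))).
apply: (desc_ae mX1 conullX1) => x Xx; apply/funext => g.
rewrite /F /restrict_cocycle /= in_fset1U; case: eqP => //= ->.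
by rewrite wW' -kappaM // mulgVK.
Qed.

Variables (pi : G -> G) (m : nat).
Hypothesis pi_near : {in wball m, forall a, (a * (pi a)^-1)%g \in wball (r + r)}.

(** Balls are connected: a net point attached to the ball of radius [l.+1] is
    within [4 r + 1] of one attached to the ball of radius [l], so every new net
    point costs at most [c]. *)
Lemma net_desc :
  let W := (1%g |` [fset pi a | a in wball m])%fset in
  describable mu (c * #|` W|%:R) (restrict_cocycle W).
Proof.
suff Hl l : (l <= m)%N -> let W := (1%g |` [fset pi a | a in wball l])%fset in
  describable mu (c * #|` W|%:R) (restrict_cocycle W) by exact: Hl.
have step (W : {fset G}) (k : nat) :
  {in wball k, forall a, exists2 w, w \in W & (pi a * w^-1)%g \in wball (r + r + 1 + (r + r))} ->
  1%g \in W ->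
  {subset W <= (1%g |` [fset pi a | a in wball k])%fset} ->
  describable mu (c * #|` W|%:R) (restrict_cocycle W) ->
  let W := (1%g |` [fset pi a | a in wball k])%fset in
  describable mu (c * #|` W|%:R) (restrict_cocycle W).
  move=> hW W1 sub dW /=.
  have -> : (1%g |` [fset pi a | a in wball k] = W `|` [fset v in [seq pi a | a <- wball k]])%fset.
    apply/fsetP => x; rewrite in_fset1U in_fsetU; apply/orP/orP.
      move=> [/eqP->|/imfsetP[a ak ->]]; first by left.
      by right; rewrite inE; apply/mapP; exists a.
    move=> [/sub|]; first by rewrite in_fset1U => /orP.
    by rewrite inE => /mapP[a ak ->]; right; apply/imfsetP; exists a.
  by apply: desc_add_seq => // v /mapP[a ak ->]; exact: hW.
elim: l => [|l IH] lm.
  apply: (step [fset 1%g]%fset).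
  - move=> a al; exists 1%g; first by rewrite inE.
    move: al; rewrite inE => /eqP ->; rewrite invg1 mulg1.
    have := pi_near (wball1 gens m); rewrite mul1g => h.
    rewrite -[pi 1%g]invgK; apply: wballV; apply: wball_le h.
    by rewrite -addnA leq_addr.
  - by rewrite inE.
  - by move=> x; rewrite inE in_fset1U => ->.
  - rewrite cardfs1 mulr1; apply: (desc_mono c0).
    apply: (desc_ae mX1 conullX1) (desc_cst mu (fun=> 1%g : H)) => x Xx.
    apply/funext => g; rewrite /restrict_cocycle inE; case: eqP => // ->.
    by rewrite (kappa1 pmp kappaM).
have {}IH := IH (ltnW lm); apply: step IH.
- move=> _ /wballSP[s sl [a al ->]]; exists (pi a).
    by rewrite in_fset1U; apply/orP; right; apply/imfsetP; exists a.
  have sam : (s * a)%g \in wball m by apply: wball_le lm _ _; exact: wballS.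
  have am : a \in wball m by apply: wball_le (ltnW lm) _ al.
  have -> : (pi (s * a) * (pi a)^-1 =
     ((s * a) * (pi (s * a))^-1)^-1 * s * (a * (pi a)^-1))%g.
    by rewrite !invgM invgK !mulgA !mulgVK.
  by apply: wballM; [apply: wballM; [exact/wballV/pi_near|exact: letter_wball]|exact: pi_near].
- by rewrite in_fset1U eqxx.
- move=> x; rewrite !in_fset1U => /orP[->//|/imfsetP[a al ->]].
  apply/orP; right; apply/imfsetP; exists a => //; exact: wball_leS.
Qed.

End NetDescription.

(** * Comparison of names over one ball *)

Section LawExtras.
Variable R : realType.

Lemma ent_law_scale (T : finType) (c : R) (p : T -> R) : 0 <= c -> (forall t, 0 <= p t) ->
  ent_law (fun t => c * p t) - eta (c * \sum_t p t) =
  c * (ent_law p - eta (\sum_t p t)).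
Proof.
rewrite le_eqVlt => /orP[/eqP<-|c0] p0.
  rewrite !mul0r eta0 subr0 /ent_law big1 // => t _; by rewrite mul0r eta0.
have etaM x : 0 <= x -> eta (c * x) = c * eta x - c * ln c * x.
  rewrite le_eqVlt => /orP[/eqP<-|x0]; first by rewrite !mulr0 eta0 mulr0 subrr.
  by rewrite /eta lnM ?posrE //; ring.
rewrite etaM ?sumr_ge0 // /ent_law (eq_bigr _ (fun t _ => etaM _ (p0 t))).
by rewrite sumrB -!mulr_sumr; ring.
Qed.

(** Superadditivity, since the law [q - p] has nonnegative entropy. *)
Lemma ent_law_mono (T : finType) (p q : T -> R) : (forall t, 0 <= p t <= q t) ->
  ent_law p - eta (\sum_t p t) <= ent_law q - eta (\sum_t q t).
Proof.
move=> pq.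
pose s (b : bool) t := if b then p t else q t - p t.
have s0 b t : 0 <= s b t by case: b; have /andP[h1 h2] := pq t; rewrite /s ?subr_ge0.
have := ent_law_superadd s0.
have -> : (fun t => \sum_b s b t) = q.
  by apply/funext => t; rewrite big_bool /s /= addrC subrK.
rewrite big_bool /=.
have -> : \sum_t \sum_b s b t = \sum_t q t.
  by apply: eq_bigr => t _; rewrite big_bool /s /= addrC subrK.
have h : 0 <= ent_law (s false) - eta (\sum_t s false t).
  have := @ent_push_le R _ _ _ (fun=> tt) id (s false) (s0 false) (fun _ _ _ _ _ => erefl).
  by rewrite ent_push_unit push_id subr_ge0.
by rewrite /s /= in h *; lra.
Qed.

End LawExtras.

Section JointCard.
Context (R : realType) d (X : measurableType d).
Variable mu : probability X R.
Variables (K : choiceType) (J : finType) (f : K -> X -> J).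
Hypothesis df : forall k, dmeas (f k).

Lemma ent_joint_le_card B (A : {fset K}) : measurable B ->
  ent mu B (joint f A) <= pr mu B * (#|` A|%:R * ln #|J|%:R).
Proof.
move=> mB; apply: le_trans (ent_le_card mu mB (dmeas_joint df A)) _.
rewrite ler_wpM2l ?pr_ge0 // card_ffun -cardfE natrX.
have [->|J0] := posnP #|J|.
  rewrite [X in _ * X]ln0 // mulr0; case: #|` A| => [|n]; first by rewrite expr0 ln1.
  by rewrite expr0n /= ln0.
by rewrite lnXn ?ltr0n // mulr_natl.
Qed.

End JointCard.

(** In this section [Q h x] is the label [Rl] at the point of the orbit of [x] to
    which [h] leads. The variable [C] is the coarse information about [x]: it
    determines the set [D] that approximates [kappa A x], the net points [Wb] at
    which the information fails, and the positions [p] of the other ones. *)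
Section CellInequality.
Context (R : realType) d (X : measurableType d).
Variable mu : probability X R.
Variables (G H : groupType) (act : G -> X -> X).
Hypothesis pmp : pmp_action mu act.
Variables (X1 : set X) (kappa : G -> X -> H).
Hypothesis mX1 : measurable X1.
Hypothesis conullX1 : mu X1 = 1%E.
Hypothesis invX1 : forall g x, X1 x -> X1 (act g x).
Hypothesis dkappa : forall g, dmeas (kappa g).
Hypothesis kappaM : forall g h x, X1 x ->
  kappa (g * h)%g x = (kappa g (act h x) * kappa h x)%g.
Hypothesis kappa_inj : forall x g h, X1 x -> kappa g x = kappa h x -> g = h.
Hypothesis kappa_surj : forall x s, X1 x -> exists g, kappa g x = s.

Variables (J J' : finType) (f : X -> J) (Rl : X -> J') (Q : H -> X -> J').
Hypothesis df : dmeas f.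
Hypothesis dRl : dmeas Rl.
Hypothesis dQ : forall h, dmeas (Q h).
Hypothesis QR : forall x g, X1 x -> Q (kappa g x) x = Rl (act g x).

Variables (A V : {fset G}) (pi : G -> G).
Hypothesis piV : {in A, forall a, pi a \in V}.
Hypothesis fR : {in A, forall a x y,
  Rl (act (pi a) x) = Rl (act (pi a) y) -> f (act a x) = f (act a y)}.

Variable E : {fset H}.
Variables (T : finType) (C : X -> T) (D : T -> {fset H}) (Wb : T -> {fset G}).
Variable p : T -> G -> H.
Hypothesis dC : dmeas C.
Hypothesis good : forall x v, X1 x -> v \in V -> v \notin Wb (C x) ->
  kappa v x = p (C x) v /\ kappa v x \in D (C x).
Hypothesis thick : forall x h e, X1 x -> h \in D (C x) -> e \in (1%g |` E)%fset ->
  exists2 a, a \in A & kappa a x = (e * h)%g.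
Hypothesis WbV : forall c, (Wb c `<=` V)%fset.

Let cell c : set X := X1 `&` C @^-1` [set c].
Let mcell c : measurable (cell c).
Proof. by apply: measurableI => //; exact: dC.2. Qed.
Let q c := pr mu (cell c).
Let lnJ : R := ln #|J'|%:R.
Let lnJ_ge0 : 0 <= lnJ.
Proof.
rewrite /lnJ; have [->|J0] := posnP #|J'|; first by rewrite ln0.
by rewrite ln_ge0 // ler1n.
Qed.
Let Wc c := [fset (e * h)%g | e in (1%g |` E)%fset, h in D c]%fset.

(** On a cell the positions of the usable net points are known, and the label [Rl]
    there determines the labels [f] at the points attached to them. For the other
    net points the label [Rl] is supplied separately. *)
Lemma cell_entropy_le c :
  ent mu (cell c) (joint (orbit_label act f) A) <=
  ent mu (cell c) (joint Q (Wc c)) + q c * (#|` Wb c|%:R * lnJ).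
Proof.
have dj (K : choiceType) (S : {fset K}) (g : K -> X -> J') (dg : forall k, dmeas (g k)) : dmeas (joint g S).
  exact: dmeas_joint.
have dor := dmeas_orbit_label pmp dRl.
apply: (@le_trans _ _ (ent mu (cell c)
   (fun x => (joint Q (Wc c) x, joint (orbit_label act Rl) (Wb c) x)))).
  apply: ent_le => //.
  - by apply: dmeas_joint; exact: (dmeas_orbit_label pmp df).
  - by apply: dmeas_pair; exact: dj.
  move=> x y [Xx /= Cx] [Xy /= Cy] [/joint_eqP eQ /joint_eqP eR].
  apply/joint_eqP => a aA; apply: (fR aA).
  have [vb|vg] := boolP (pi a \in Wb c); first exact: eR.
  have vx : pi a \notin Wb (C x) by rewrite Cx.
  have vy : pi a \notin Wb (C y) by rewrite Cy.
  have [kx kD] := good Xx (piV aA) vx; have [ky _] := good Xy (piV aA) vy.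
  rewrite -!QR // kx ky Cx Cy; apply: eQ; rewrite -Cx -kx.
  by apply/imfset2P; exists 1%g; rewrite ?fset1U1 //; exists (kappa (pi a) x); rewrite ?mul1g.
apply: le_trans (ent_pair_le mu (mcell c) _ _) _; [exact: dj|exact: dj|].
by rewrite lerD2l; exact: ent_joint_le_card.
Qed.

(** The set [Wc c] lies in [kappa A x] for [x] in the cell, hence has at most [|A|]
    elements. *)
Lemma cell_shearer c :
  #|` E|%:R * ent mu (cell c) (joint Q (Wc c)) <=
  \sum_(h <- D c) ent mu (cell c) (joint Q (rtranslate E h))
  + #|` E|%:R * (q c * (#|` A|%:R - #|` D c|%:R) * lnJ).
Proof.
apply: le_trans (group_shearer mu dQ (mcell c) (_ : forall e h, e \in E -> h \in D c ->
  (e * h)%g \in Wc c)) _.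
  move=> e h eE hD; apply/imfset2P; exists e; first by rewrite inE eE orbT.
  by exists h.
rewrite lerD2l ler_wpM2l ?ler0n // mulrA ler_wpM2r //.
rewrite mulrC; have [c0|] := eqVneq (cell c) set0.
  by rewrite /q c0 pr0 !mul0r.
move=> /set0P[x [Xx Cx]]; rewrite ler_wpM2l ?pr_ge0 // lerD2r ler_nat.
have sub : (Wc c `<=` [fset kappa a x | a in A])%fset.
  apply/fsubsetP => _ /imfset2P[e eE [h hD ->]]; rewrite -Cx in hD.
  by have [a aA <-] := thick Xx hD eE; apply/imfsetP; exists a.
by apply: leq_trans (fsubset_leq_card sub) _; exact: leq_imfset_card.
Qed.

Lemma sum_bad : \sum_c q c * #|` Wb c|%:R =
  \sum_(v <- V) pr mu (X1 `&` [set x | v \in Wb (C x)]).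
Proof.
have -> : \sum_(v <- V) pr mu (X1 `&` [set x | v \in Wb (C x)]) =
    \sum_(v <- V) \sum_c (if v \in Wb c then q c else 0).
  apply: eq_bigr => v _; rewrite (pr_split mu _ dC).
    apply: eq_bigr => c _; case: ifPn => [vc|/negP vc].
      by congr pr; rewrite eqEsubset; split=> x /= [] => [[Xx _] <-|Xx Cx] //; rewrite /cell /= Cx.
    rewrite -(pr0 mu); congr pr; rewrite -subset0 => x /= [[_ h] Cx].
    by apply: vc; rewrite -Cx.
  by apply: measurableI => //; exact: (dmeas_preimage [set c | v \in Wb c] dC).
rewrite exchange_big /=; apply: eq_bigr => c _.
rewrite -big_mkcond /= -big_filter (perm_big (Wb c : seq G)) /=.
  by rewrite big_const_seq count_predT iter_addr_0 mulr_natr.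
apply: uniq_perm; rewrite ?filter_uniq ?fset_uniq // => v.
by rewrite mem_filter; apply: andb_idr; exact/fsubsetP/WbV.
Qed.

(** Since [kappa] is injective along the orbit, every element of [D] is [kappa a x]
    for at most one [a]. *)
Lemma sum_defect : \sum_c q c * (#|` A|%:R - #|` D c|%:R) <=
  \sum_(a <- A) pr mu (X1 `&` [set x | kappa a x \notin D (C x)]).
Proof.
have mka a h : measurable (kappa a @^-1` [set h]) by exact: (dkappa a).2.
have hD c : \sum_(a <- A) pr mu (cell c `&` kappa a @^-1` [set h | h \in D c]) <=
    q c * #|` D c|%:R.
  apply: (@le_trans _ _ (\sum_(a <- A) \sum_(h <- D c) pr mu (cell c `&` kappa a @^-1` [set h]))).
    apply: ler_sum => a _.
    have mF h : measurable (cell c `&` kappa a @^-1` [set h]) by exact: measurableI.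
    apply: le_trans (pr_bigcup_le mu (F := fun h => cell c `&` kappa a @^-1` [set h]) (fun h _ => mF h)).
    apply: pr_mono.
    - by apply: measurableI => //; exact: dmeas_preimage.
    - by apply: fin_bigcup_measurable => //; exact: finite_seq.
    - by move=> x [cx /= kD]; exists (kappa a x).
  rewrite exchange_big /= mulr_natr -iter_addr_0 -(count_predT (D c)) -big_const_seq.
  apply: ler_sum => h _; rewrite -pr_bigcup.
  - apply: pr_mono => //; last by move=> x [a _ []].
    by apply: fin_bigcup_measurable => // a _; exact: measurableI.
  - by move=> a _; exact: measurableI.
  - by move=> a b _ _ [x [[[Xx _] /= ka] [_ /= kb]]]; apply: (kappa_inj Xx); rewrite ka.
have -> : \sum_(a <- A) pr mu (X1 `&` [set x | kappa a x \notin D (C x)]) =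
    \sum_c \sum_(a <- A) (q c - pr mu (cell c `&` kappa a @^-1` [set h | h \in D c])).
  rewrite exchange_big /=; apply: eq_bigr => a _.
  have mD : measurable [set x | kappa a x \notin D (C x)].
    exact: (dmeas_preimage [set z | z.1 \notin D z.2] (dmeas_pair (dkappa a) dC)).
  rewrite (pr_split mu _ dC); last exact: measurableI.
  apply: eq_bigr => c _; apply/eqP; rewrite eq_sym subr_eq; apply/eqP.
  rewrite /q (pr_split mu (mcell c) (dmeas_bool (dmeas_preimage [set h | h \in D c] (dkappa a)))).
  rewrite big_bool /= addrC; congr (_ + _); congr pr; rewrite eqEsubset; split=> x /=.
  - by move=> [[Xx Cx] /asboolPn kD]; split=> //; split=> //; rewrite Cx; apply/negP.
  - by move=> [[Xx kD] Cx]; split; [split|apply/asboolPn/negP; rewrite -Cx].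
  - by move=> [cx kD]; split=> //; apply/asboolP; rewrite kD.
  - by move=> [cx kD]; split=> //; apply/asboolP.
apply: ler_sum => c _; rewrite sumrB mulrBr big_const_seq count_predT iter_addr_0 mulr_natr.
by rewrite lerD2l lerN2.
Qed.


Let QE (h : H) (x : X) : {ffun E -> J'} := [ffun e => Q (val e * h)%g x].

Let dQE h : dmeas (QE h).
Proof. by apply: dmeas_ffun => e; exact: dQ. Qed.

Let QE_orbit x a : X1 x -> QE (kappa a x) x = joint Q E (act a x).
Proof.
move=> Xx; apply/ffunP => e; rewrite !ffunE.
have [g <-] := kappa_surj (val e) (invX1 a Xx).
rewrite QR; last exact: invX1.
by rewrite -kappaM // QR // (pmp_actM pmp).
Qed.

(** Restricted to the cells and summed over all [h] in [D], the laws of the [E]-name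
    at [h x] are dominated by the sum over [a] in [A] of the laws of the [E]-name
    at [a x], which is [|A|] times a single law by invariance. Superadditivity of
    the unnormalized entropy turns this domination into the inequality, whatever
    the correlation between [D] and the names. *)
Lemma sum_translates :
  \sum_c \sum_(h <- D c) ent mu (cell c) (joint Q (rtranslate E h)) <=
  #|` A|%:R * ent mu setT (joint Q E).
Proof.
have dj := dmeas_joint dQ E.
have entE c h : ent mu (cell c) (joint Q (rtranslate E h)) = ent mu (cell c) (QE h).
  apply: ent_eq => //; first exact: dmeas_joint.
    move=> x y _ _ /ffunP e; apply/joint_eqP => g; rewrite mem_rtranslate => gE.
    by have := e [` gE]%fset; rewrite !ffunE /= mulgVK.
  move=> x y _ _ /joint_eqP e; apply/ffunP => g; rewrite !ffunE; apply: e.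
  by rewrite mem_rtranslate mulgK; exact: valP.
pose DD := (\bigcup_(c <- enum T) D c)%fset.
have DDP c : (D c `<=` DD)%fset by apply: bigfcup_sup => //; rewrite mem_enum.
pose P (i : T * DD) r := if val i.2 \in D i.1 then law mu (cell i.1) (QE (val i.2)) r else 0.
have P0 i r : 0 <= P i r by rewrite /P; case: ifP => // _; exact: law_ge0.
pose lam := law mu setT (joint Q E).
apply: (@le_trans _ _ (\sum_i (ent_law (P i) - eta (\sum_r P i r)))).
  rewrite -(pair_bigA _ (fun c u => ent_law (P (c, u)) - eta (\sum_r P (c, u) r))) /=.
  apply: ler_sum => c _.
  apply: (@le_trans _ _ (\sum_(h <- DD | h \in D c) ent mu (cell c) (QE h))).
    rewrite -[leRHS]big_filter [leRHS](perm_big (D c : seq H)) /=.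
      by apply: ler_sum => h _; rewrite entE.
    apply: uniq_perm; rewrite ?filter_uniq ?fset_uniq // => h.
    by rewrite mem_filter; apply: andb_idr; exact/fsubsetP.
  rewrite big_mkcond big_seq_fsetE /=; apply: ler_sum => u _; rewrite /P /=; case: ifP => uD.
    by rewrite /ent law_sum.
  by rewrite /ent_law !big1 ?eta0 ?subr0 // => r _; rewrite eta0.
apply: le_trans (ent_law_superadd P0) _.
have Ple r : \sum_i P i r <= #|` A|%:R * lam r.
  have pa a : pr mu (X1 `&` (joint Q E \o act a) @^-1` [set r]) = lam r.
    rewrite pr_setI_conull //; last exact: (dmeas_transform (pmp_measurable pmp a) dj).2.
    rewrite /lam /law setTI /pr comp_preimage (pmp_preserving pmp) //; exact: dj.2.
  have -> : #|` A|%:R * lam r =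
      \sum_(a <- A) pr mu (X1 `&` (joint Q E \o act a) @^-1` [set r]).
    rewrite (eq_bigr (fun=> lam r)) => [|a _]; last exact: pa.
    by rewrite big_const_seq count_predT iter_addr_0 mulr_natl.
  pose S a (i : T * DD) := cell i.1 `&` kappa a @^-1` [set val i.2]
     `&` (joint Q E \o act a) @^-1` [set r].
  have mS a i : measurable (S a i).
    apply: measurableI; last exact: (dmeas_transform (pmp_measurable pmp a) dj).2.
    by apply: measurableI => //; exact: (dkappa a).2.
  apply: (@le_trans _ _ (\sum_i \sum_(a <- A) pr mu (S a i))).
    apply: ler_sum => -[c u] _; rewrite /P /=; case: ifP => uD; last first.
      by apply: sumr_ge0 => a _; exact: pr_ge0.
    apply: le_trans (pr_bigcup_le mu (F := fun a => S a (c, u)) (fun a _ => mS a (c, u))).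
    apply: pr_mono.
    - by apply: measurableI => //; exact: (dQE _).2.
    - by apply: fin_bigcup_measurable => //; exact: finite_seq.
    - move=> x [[Xx /= Cx] /= Qx]; have uDx : val u \in D (C x) by rewrite Cx.
      have [a aA] := thick Xx uDx (fset1U1 _ _); rewrite mul1g => ka.
      by exists a => //; split=> //=; rewrite -QE_orbit // ka.
  rewrite exchange_big /=; apply: ler_sum => a _.
  have dF : dmeas (fun x => (C x, insub (kappa a x) : option DD)).
    exact: dmeas_pair dC (dmeas_comp insub (dkappa a)).
  rewrite (pr_split mu _ dF); last first.
    by apply: measurableI => //; exact: (dmeas_transform (pmp_measurable pmp a) dj).2.
  pose K (z : T * option DD) := pr mu (X1 `&` (joint Q E \o act a) @^-1` [set r] `&`
     (fun x => (C x, insub (kappa a x) : option DD)) @^-1` [set z]).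
  rewrite -/(K _) [leRHS](_ : _ = \sum_c \sum_o K (c, o)); last by rewrite pair_bigA; apply: eq_bigr => -[].
  rewrite -(pair_bigA _ (fun c u => pr mu (S a (c, u)))) /=; apply: ler_sum => c _.
  rewrite sum_option -[leLHS]add0r; apply: lerD; first exact: pr_ge0.
  apply: ler_sum => u _; apply: pr_mono => //.
    apply: measurableI; last exact: dF.2.
    by apply: measurableI => //; exact: (dmeas_transform (pmp_measurable pmp a) dj).2.
  by move=> x [[[Xx /= Cx] /= ka] /= Qx]; split=> //=; rewrite ka valK Cx.
have lam_ge0 r : 0 <= lam r by exact: law_ge0.
apply: le_trans (ent_law_mono (q := fun r => #|` A|%:R * lam r) _) _.
  by move=> r; rewrite Ple andbT; apply: sumr_ge0.
rewrite -mulr_sumr ent_law_scale ?ler0n // ler_wpM2l ?ler0n //.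
by rewrite /ent -/lam law_sum.
Qed.

(** The last factor is the expected number of unusable net points plus the expected
    number of points of [A] that [D] misses. *)
Theorem cell_inequality :
  #|` E|%:R * ent mu setT (joint (orbit_label act f) A) <=
  #|` E|%:R * ent mu setT C + #|` A|%:R * ent mu setT (joint Q E) +
  #|` E|%:R * lnJ *
    (\sum_(v <- V) pr mu (X1 `&` [set x | v \in Wb (C x)]) +
     \sum_(a <- A) pr mu (X1 `&` [set x | kappa a x \notin D (C x)])).
Proof.
have djf : dmeas (joint (orbit_label act f) A).
  by apply: dmeas_joint; exact: (dmeas_orbit_label pmp df).
rewrite (ent_conull mX1 conullX1 djf) (ent_conull mX1 conullX1 dC).
have E0 : 0 <= #|` E|%:R :> R by [].
have h1 : ent mu X1 (joint (orbit_label act f) A) <=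
   ent mu X1 C + \sum_c ent mu (cell c) (joint (orbit_label act f) A).
  rewrite -ent_chain //; apply: ent_le => //; first exact: dmeas_pair.
  by move=> x y _ _ [].
have h2 : \sum_c ent mu (cell c) (joint (orbit_label act f) A) <=
   \sum_c ent mu (cell c) (joint Q (Wc c)) + (\sum_c q c * #|` Wb c|%:R) * lnJ.
  rewrite mulr_suml -big_split; apply: ler_sum => c _.
  by rewrite -mulrA; exact: cell_entropy_le.
have h3 : #|` E|%:R * \sum_c ent mu (cell c) (joint Q (Wc c)) <=
   #|` A|%:R * ent mu setT (joint Q E) +
   #|` E|%:R * ((\sum_c q c * (#|` A|%:R - #|` D c|%:R)) * lnJ).
  apply: le_trans (lerD sum_translates (lexx _)).
  rewrite mulr_sumr mulr_suml mulr_sumr -big_split; apply: ler_sum => c _.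
  exact: cell_shearer.
rewrite sum_bad in h2.
have h4 := sum_defect.
apply: le_trans (ler_wpM2l E0 (le_trans h1 (lerD (lexx _) h2))) _.
have h5 : #|` E|%:R * ((\sum_c q c * (#|` A|%:R - #|` D c|%:R)) * lnJ) <=
   #|` E|%:R * ((\sum_(a <- A) pr mu (X1 `&` [set x | kappa a x \notin D (C x)])) * lnJ).
  by rewrite ler_wpM2l // ler_wpM2r.
move: h3 h5; set x1 := \sum_c _; set x2 := \sum_c _; set x3 := \sum_(v <- V) _.
set x4 := \sum_(a <- A) _ => h3 h5.
lra.
Qed.

End CellInequality.

(** * The main estimate *)

Section NetSums.
Variables (R : realType) (G : groupType).

Lemma sum_over_fibers (A V B : {fset G}) (pi : G -> G) (b : G -> R) :
  {in A, forall a, pi a \in V} -> {in A, forall a, (a * (pi a)^-1)%g \in B} ->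
  (forall v, 0 <= b v) ->
  \sum_(a <- A) b (pi a) <= #|` B|%:R * \sum_(v <- V) b v.
Proof.
move=> piV piB b0.
have -> : \sum_(a <- A) b (pi a) = \sum_(a <- A) \sum_(v <- V | pi a == v) b v.
  rewrite big_seq [RHS]big_seq; apply: eq_bigr => a aA.
  rewrite big_mkcond (big_fsetD1 (pi a)) ?piV //= eqxx big_seq big1 ?addr0 // => v.
  by rewrite !inE eq_sym => /andP[/negbTE->].
under eq_bigr do rewrite big_mkcond.
rewrite exchange_big /= mulr_sumr; apply: ler_sum => v _.
rewrite -big_mkcond -big_filter big_const_seq count_predT iter_addr_0 -[leLHS]mulr_natl.
rewrite ler_wpM2r // ler_nat -(size_map (fun a => a * v^-1)%g).
apply: uniq_leq_size.
  by rewrite map_inj_uniq ?filter_uniq ?fset_uniq //; exact: mulIg.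
move=> x /mapP[a]; rewrite mem_filter => /andP[/eqP <- aA] ->; exact: piB.
Qed.

End NetSums.

Section MainEstimate.
Context (R : realType) d (X : measurableType d).
Variable mu : probability X R.
Variables (G H : groupType) (act : G -> X -> X).
Hypothesis pmp : pmp_action mu act.
Variables (X1 : set X) (kappa : G -> X -> H).
Hypothesis mX1 : measurable X1.
Hypothesis conullX1 : mu X1 = 1%E.
Hypothesis invX1 : forall g x, X1 x -> X1 (act g x).
Hypothesis dkappa : forall g, dmeas (kappa g).
Hypothesis kappaM : forall g h x, X1 x ->
  kappa (g * h)%g x = (kappa g (act h x) * kappa h x)%g.
Hypothesis kappa_inj : forall x g h, X1 x -> kappa g x = kappa h x -> g = h.
Hypothesis kappa_surj : forall x s, X1 x -> exists g, kappa g x = s.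
Variable gens : seq G.
Hypothesis gensP : forall S : {pred G}, group_closed S -> {subset gens <= S} ->
  forall g, g \in S.
Local Notation wball := (wball gens).

Definition unreached (M : {fset G}) (k : H) : set X :=
  X1 `&` [set x | forall g, g \in M -> kappa g x <> k].

Lemma measurable_unreached M k : measurable (unreached M k).
Proof.
apply: measurableI => //.
have -> : [set x | forall g, g \in M -> kappa g x <> k] =
    \bigcap_(g in [set` M]) ~` (kappa g @^-1` [set k]).
  by rewrite eqEsubset; split=> x h g; exact: h.
apply: fin_bigcap_measurable => // g _; apply: measurableC; exact: (dkappa g).2.
Qed.

(** Almost every [x] has some [g] with [kappa g x = k], and the balls exhaust [G]. *)
Lemma unreached_small k (e : R) : 0 < e ->
  exists i, forall j, (i <= j)%N -> pr mu (unreached (wball j) k) <= e.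
Proof.
move=> e0; pose B j := X1 `\` unreached (wball j) k.
have mB j : measurable (B j) by apply: measurableD => //; exact: measurable_unreached.
have BT : \bigcup_j B j = X1.
  rewrite eqEsubset; split=> [x [j _ []]//|x Xx].
  have [g gk] := kappa_surj k Xx; have [j gj] := wball_cover gensP g.
  by exists j => //; split=> // -[_ /(_ g gj)].
have h : mu \o B @ \oo --> mu (\bigcup_j B j).
  apply: nondecreasing_cvg_mu => //; first by rewrite BT.
  move=> i j ij; apply/subsetPset => x [Xx nu]; split=> // -[_ h]; apply: nu; split=> // g gi.
  by apply: h; exact: wball_le gi.
rewrite BT conullX1 in h.
have /fine_cvgP[_ /cvgrPdist_le/(_ _ e0)[i _ hi]] := h.
exists i => j /hi /=; rewrite -/(pr mu (B j)) => /(le_trans (ler_norm _)).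
apply: le_trans; rewrite -prC //.
apply: pr_mono; [exact: measurable_unreached|exact: measurableC|].
by move=> x ux [_].
Qed.


(** The radius [m0] is chosen such that the ball hardly grows between the radii
    [m0] and [m0 + 2 (k + r)]. Net points outside the ball of radius [m0 + r]
    carry disjoint sets in the shell between these radii, hence are few; the other
    ones stay in [A] after multiplication by the ball of radius [k]. *)
Lemma folner_ball_net r k (e : R) : virtually_abelian G -> 0 < e -> e <= 1 ->
  exists m0 (V : {fset G}) (pi : G -> G), let A := wball (m0 + k + r) in
  [/\ {in A, forall a, pi a \in V} /\ {in A, forall a, (a * (pi a)^-1)%g \in wball (r + r)},
     (V `<=` A)%fset, {in V, forall v, pi v = v},
     #|` V|%:R * #|` wball r|%:R <= 2 * #|` A|%:R :> R &
     #|` [fset v in V | v \notin wball (m0 + r)]%fset|%:R <= e * #|` A|%:R :> R].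
Proof.
move=> vaG e0 e1; have [m0 hm0] := @wball_slow_growth R G gens vaG (k + k + r + r) e e0.
have [V [pi [sV VA piV piB]]] := exists_net gens r (wball (m0 + k + r)).
exists m0, V, pi => /=; split=> //.
  move=> v vV; have vA := fsubsetP VA v vV; apply/esym/sV => //; first exact: piV.
  exact: piB.
  rewrite -natrM; apply: (@le_trans _ _ #|` wball (m0 + (k + k + r + r))|%:R).
    rewrite ler_nat; apply: (card_spread_out sV) => t v tr /(fsubsetP VA) vA.
    by apply: wball_le (wballM tr vA); lia.
  apply: le_trans hm0 _; apply: ler_pM; rewrite ?addr_ge0 ?(ltW e0) //; first lra.
  rewrite ler_nat; apply: fsubset_leq_card; apply/fsubsetP; apply: wball_le.
  by rewrite -addnA leq_addr.
set W := [fset v in V | _]%fset.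
have h : (#|` W| * #|` wball r| + #|` wball m0| <= #|` wball (m0 + (k + k + r + r))|)%N.
  have sW : spread_out gens r W.
    by move=> v w; rewrite !inE => /andP[vV _] /andP[wV _]; exact: sV.
  rewrite -(cardfsID (wball m0) (wball (m0 + (k + k + r + r)))) addnC leq_add //.
    apply: fsubset_leq_card; apply/fsubsetP => x xm; rewrite inE xm andbT.
    by apply: wball_le xm; rewrite leq_addr.
  apply: (card_spread_out sW) => t v tr; rewrite !inE => /andP[vV vm].
  have vA := fsubsetP VA v vV; apply/andP; split.
    apply: contra vm => tvm; rewrite -(mulKg t v) addnC.
    by apply: wballM => //; exact: wballV.
  by apply: wball_le (wballM tr vA); lia.
have b1 : (0 < #|` wball r|)%N.
  by rewrite cardfs_gt0; apply/fset0Pn; exists 1%g; exact: wball1.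
have : #|` W|%:R + #|` wball m0|%:R <= (1 + e) * #|` wball m0|%:R :> R.
  apply: le_trans hm0; rewrite -natrD ler_nat; apply: leq_trans h.
  by rewrite leq_add2r leq_pmulr.
rewrite mulrDl mul1r addrC lerD2l => /le_trans; apply.
rewrite ler_wpM2l ?(ltW e0) // ler_nat; apply: fsubset_leq_card.
by apply/fsubsetP; apply: wball_le; rewrite -addnA leq_addr.
Qed.

Section Choice.
Hypothesis vaG : virtually_abelian G.
Variables (J : finType) (f : X -> J).
Hypothesis df : dmeas f.
Variables (r : nat) (c : R).
Hypothesis c0 : 0 <= c.
Hypothesis kappa_desc : forall u, u \in wball (r + r + 1 + (r + r)) ->
  describable mu c (kappa u).

Let J' : finType := {ffun wball (r + r) -> J}.
Let Rl : X -> J' := joint (orbit_label act f) (wball (r + r)).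

(** The last error term is the cost of the coarse information per point of [A]:
    at most [2 c + 1] for each net point, and at most [2 / |B_r|] net points. *)
Lemma main_estimate_radius (E : {fset H}) (Q : H -> X -> J') (e : R) :
  E != fset0 -> 0 < e ->
  (forall h, dmeas (Q h)) ->
  (forall x g, X1 x -> Q (kappa g x) x = Rl (act g x)) ->
  exists2 A : {fset G}, A != fset0 &
    mean_ent mu act f A <= ent mu setT (joint Q E) / #|` E|%:R + e
      + (2 * c + 1) * (2 / #|` wball r|%:R).
Proof.
move=> E0 e0 dQ QR.
have dRl : dmeas Rl by apply: dmeas_joint; exact: (dmeas_orbit_label pmp df).
have lnJ_ge0 : 0 <= ln #|J'|%:R :> R.
  have [->|J0] := posnP #|J'|; first by rewrite ln0.
  by rewrite ln_ge0 // ler1n.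
pose b2 : R := #|` wball (r + r)|%:R.
(* [et] bounds every single error. Unusable net points contribute at most [5 et] per
   point of [A], and the points missed by [D] at most [et + b2 * (5 et)]. *)
pose eta0 := e / ((ln #|J'|%:R + 1) * (6 + 5 * b2)).
pose et := Num.min 1 eta0.
have b20 : 0 <= b2 by rewrite /b2.
have den0 : 0 < (ln #|J'|%:R + 1) * (6 + 5 * b2).
  by rewrite mulr_gt0 //; [rewrite ltr_wpDl|rewrite ltr_wpDr // mulr_ge0].
have et0 : 0 < et by rewrite lt_min ltr01 divr_gt0.
have et1 : et <= 1 by rewrite ge_min lexx.
have ete : ln #|J'|%:R * (et * (6 + 5 * b2)) <= e.
  apply: (@le_trans _ _ (et * ((ln #|J'|%:R + 1) * (6 + 5 * b2)))).
    rewrite mulrCA ler_wpM2l ?(ltW et0) // ler_wpM2r // ?lerDl //.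
    by rewrite addr_ge0 // mulr_ge0.
  by rewrite -ler_pdivlMr // ge_min lexx orbT.
pose Lt t : {fset H} := sval (cid (dmeas_tail mu (dkappa t) et0)).
have LtP t S1 : (Lt t `<=` S1)%fset -> pr mu (kappa t @^-1` [set s | s \notin S1]) <= et.
  by rewrite /Lt; case: cid => ? h; exact: h.
pose L := (1%g |` \bigcup_(t <- wball (r + r)) Lt t)%fset.
have LP t : t \in wball (r + r) -> pr mu (kappa t @^-1` [set s | s \notin L]) <= et.
  move=> tr; apply: LtP; apply: fsubset_trans (fsubsetU1 _ _).
  exact: bigfcup_sup.
pose E' := (1%g |` E)%fset.
pose K := [fset (x * y)%g | x in E', y in L]%fset.
pose et2 := et / #|` K|.+1%:R.
have et20 : 0 < et2 by rewrite divr_gt0.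
pose ik k := sval (cid (unreached_small k et20)).
have ikP k j : (ik k <= j)%N -> pr mu (unreached (wball j) k) <= et2.
  by rewrite /ik; case: cid => i h; exact: h.
pose k0 := (\max_(k <- K) ik k)%N.
have k0P k : k \in K -> pr mu (unreached (wball k0) k) <= et2.
  by move=> kK; apply: ikP; exact: leq_bigmax_seq.
have [m0 [V [pi [[piV piB] VA piid hV hW]]]] := folner_ball_net r k0 vaG et0 et1.
set m := (m0 + k0 + r)%N in piV piB VA piid hV hW *; set A := wball m in piV piB VA piid hV hW *.
have A1 : 1%g \in A by exact: wball1.
have A0 : A != fset0 by apply/fset0Pn; exists 1%g.
exists A => //.
have dW := net_desc pmp mX1 conullX1 kappaM c0 kappa_desc piB.
set W := (1%g |` _)%fset in dW.
have VW v : v \in V -> v \in W.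
  move=> vV; rewrite in_fset1U; apply/orP; right; apply/imfsetP; exists v.
    exact: (fsubsetP VA).
  by rewrite piid.
have V1 : (0 < #|` V|)%N by rewrite cardfs_gt0; apply/fset0Pn; exists (pi 1%g); exact: piV.
have cardW : #|` W|%:R <= 2 * #|` V|%:R :> R.
  rewrite -natrM ler_nat mul2n -addnn.
  have sub : (W `<=` 1%g |` V)%fset.
    apply/fsubsetP => v; rewrite !in_fset1U => /orP[->//|/imfsetP[a aA ->]].
    by rewrite (piV a aA) orbT.
  apply: leq_trans (fsubset_leq_card sub) _; rewrite cardfsU1 leq_add2r.
  by apply: leq_trans (leq_b1 _) _.
have [T [Z [dec [N [dZ mN Ne Zc decP]]]]] := dW _ et0.
(* A net point is usable at [x] if the positions are decoded correctly there and if
   the set [K], translated to its position, does not leave [kappa A x]. *)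
pose okay x v := ~ N x /\ (X1 x /\ forall k, k \in K -> exists2 a, a \in A & kappa a x = (k * kappa v x)%g).
pose b x : {ffun V -> bool} := [ffun v => `[< okay x (val v) >]].
pose C x := (Z x, b x).
pose Wb (z : T * {ffun V -> bool}) : {fset G} :=
  [fset v in V | if insub v is Some u then ~~ z.2 u else true]%fset.
pose p (z : T * {ffun V -> bool}) := dec z.1.
pose D (z : T * {ffun V -> bool}) : {fset H} :=
  [fset (l * p z v)%g | l in L, v in (V `\` Wb z)%fset]%fset.
have WbE x v : v \in V -> (v \in Wb (C x)) = ~~ `[< okay x v >].
  by move=> vV; rewrite !inE vV insubT /= ffunE.
have mokay v : measurable [set x | okay x v].
  have -> : [set x | okay x v] = ~` N `&` (X1 `&` \bigcap_(k in [set` K])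
      \bigcup_(a in [set` A]) [set x | kappa a x = (k * kappa v x)%g]).
    rewrite eqEsubset; split=> x [nN [Xx h]]; split=> //; split=> // k kK;
      by have [a aA E2] := h k kK; exists a.
  apply: measurableI; first exact: measurableC.
  apply: measurableI => //.
  apply: fin_bigcap_measurable => // k _; apply: fin_bigcup_measurable => // a _.
  exact: (dmeas_preimage [set z | z.1 = (k * z.2)%g] (dmeas_pair (dkappa a) (dkappa v))).
have db : dmeas b by apply: dmeas_ffun => v; exact: (dmeas_bool (mokay (val v))).
have dC : dmeas C by exact: dmeas_pair.
have good x v : X1 x -> v \in V -> v \notin Wb (C x) ->
    kappa v x = p (C x) v /\ kappa v x \in D (C x).
  move=> Xx vV vW; have := vW; rewrite WbE // negbK => /asboolP[nN _].
  have pE : p (C x) v = kappa v x by rewrite /p /= decP // /restrict_cocycle VW.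
  split=> //; apply/imfset2P; exists 1%g; first by rewrite fset1U1.
  by exists v; rewrite ?mul1g //= in_fsetD vW.
have thick x h e' : X1 x -> h \in D (C x) -> e' \in (1%g |` E)%fset ->
    exists2 a, a \in A & kappa a x = (e' * h)%g.
  move=> Xx /imfset2P[l lL [v]]; rewrite /= in_fsetD => /andP[vW vV] -> eE.
  have [<- _] := good x v Xx vV vW.
  move: vW; rewrite WbE // negbK => /asboolP[_ [_ /(_ (e' * l)%g)]].
  rewrite -mulgA; apply; apply/imfset2P; exists e' => //; by exists l.
have WbV z : (Wb z `<=` V)%fset by apply/fsubsetP => v; rewrite !inE => /andP[].
have fR : {in A, forall a x y, Rl (act (pi a) x) = Rl (act (pi a) y) ->
    f (act a x) = f (act a y)}.
  move=> a aA x y /joint_eqP/(_ _ (piB a aA)).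
  by rewrite /orbit_label -!(pmp_actM pmp) mulgVK.
have main := cell_inequality pmp mX1 conullX1 invX1 dkappa kappaM kappa_inj kappa_surj
  df dRl dQ QR piV fR dC good thick WbV.
pose beta v := pr mu (X1 `&` [set x | v \in Wb (C x)]).
pose gamma a := pr mu (X1 `&` [set x | kappa a x \notin D (C x)]).
have mbeta v : measurable (X1 `&` [set x | v \in Wb (C x)]).
  by apply: measurableI => //; exact: (dmeas_preimage [set z | v \in Wb z] dC).
have mgamma a : measurable (X1 `&` [set x | kappa a x \notin D (C x)]).
  apply: measurableI => //.
  exact: (dmeas_preimage [set z | z.1 \notin D z.2] (dmeas_pair (dkappa a) dC)).
have beta0 v : 0 <= beta v by exact: pr_ge0.
have betaP v : v \in V -> beta v <= 2 * et + (v \notin wball (m0 + r))%:R.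
  move=> vV; have [vm|vm] := boolP (v \in wball (m0 + r)); last first.
    apply: (@le_trans _ _ 1); first exact: pr_le1.
    by rewrite lerDr mulr_ge0 // ltW.
  rewrite addr0.
  have mU k : measurable (act v @^-1` unreached (wball k0) k).
    rewrite -[X in measurable X]setTI; apply: (pmp_measurable pmp) => //.
    exact: measurable_unreached.
  have mUU : measurable (\bigcup_(k in [set` K]) act v @^-1` unreached (wball k0) k).
    by apply: fin_bigcup_measurable.
  apply: (@le_trans _ _ (pr mu (N `|` \bigcup_(k in [set` K]) act v @^-1` unreached (wball k0) k))).
    apply: pr_mono => //; first exact: measurableU.
    move=> x [Xx /=]; rewrite WbE // => /asboolPn nok.
    have [Nx|nNx] := pselect (N x); [by left|right].
    apply: contrapT => nk; apply: nok; split=> //; split=> // k kK.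
    apply: contrapT => na; apply: nk; exists k => //; split; first exact: invX1.
    move=> g gk0 gk; apply: na; exists (g * v)%g; last by rewrite kappaM // gk.
    by apply: wball_le (wballM gk0 vm); rewrite addnA [(k0 + m0)%N]addnC.
  apply: le_trans (pr_setU_le mu mN mUU) _; rewrite mulr_natl mulr2n; apply: lerD => //.
  apply: le_trans (pr_bigcup_le mu (s := K) (F := fun k => act v @^-1` unreached (wball k0) k) (fun k _ => mU k)) _.
  apply: (@le_trans _ _ (\sum_(k <- K) et2)).
    rewrite big_seq [leRHS]big_seq; apply: ler_sum => k kK.
    rewrite /pr (pmp_preserving pmp); first exact: k0P.
    exact: measurable_unreached.
  rewrite big_const_seq count_predT iter_addr_0 -[leLHS]mulr_natr /et2 -mulrA.
  by rewrite ler_piMr ?(ltW et0) // mulrC ler_pdivrMr // mul1r ler_nat.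
have gammaP a : a \in A -> gamma a <= beta (pi a) + et.
  move=> aA; have paV := piV a aA.
  set t := (a * (pi a)^-1)%g; have tr : t \in wball (r + r) by exact: piB.
  have mt : measurable (act (pi a) @^-1` (kappa t @^-1` [set s | s \notin L])).
    rewrite -[X in measurable X]setTI; apply: (pmp_measurable pmp) => //.
    exact: dmeas_preimage.
  apply: (@le_trans _ _ (pr mu ((X1 `&` [set x | pi a \in Wb (C x)]) `|`
     act (pi a) @^-1` (kappa t @^-1` [set s | s \notin L])))).
    apply: pr_mono => //; first exact: measurableU.
    move=> x [Xx /= kD]; have [vb|vg] := boolP (pi a \in Wb (C x)); first by left; split.
    right; apply: contra kD => tL.
    have [pE _] := good x (pi a) Xx paV vg.
    apply/imfset2P; exists (kappa t (act (pi a) x)) => //.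
    exists (pi a); first by rewrite /= in_fsetD vg.
    by rewrite -pE -kappaM // mulgVK.
  apply: le_trans (pr_setU_le mu (mbeta _) mt) _; rewrite lerD2l.
  rewrite {1}/pr (pmp_preserving pmp); first exact: LP.
  exact: dmeas_preimage.
set n : R := #|` A|%:R in hV hW main *.
have n0 : 0 < n by rewrite ltr0n cardfs_gt0.
have b1 : 1 <= #|` wball r|%:R :> R.
  by rewrite ler1n cardfs_gt0; apply/fset0Pn; exists 1%g; exact: wball1.
have Vn : #|` V|%:R <= 2 * n by apply: le_trans hV; rewrite ler_peMr.
have sbeta : \sum_(v <- V) beta v <= 5 * et * n.
  apply: (@le_trans _ _ (\sum_(v <- V) (2 * et + (v \notin wball (m0 + r))%:R))).
    by rewrite big_seq [leRHS]big_seq; apply: ler_sum => v; exact: betaP.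
  rewrite big_split /= big_const_seq count_predT iter_addr_0 -[X in X + _]mulr_natr.
  rewrite -natr_sum -[X in _ + X%:R]/(\sum_(v <- V) _)%N.
  have -> : (\sum_(v <- V) (v \notin wball (m0 + r)) =
      #|` [fset v in V | v \notin wball (m0 + r)]%fset|)%N.
    rewrite card_fset_filter -sum1_count [RHS]big_mkcond.
    by apply: eq_bigr => v _; case: (_ \notin _).
  have := ler_wpM2l (ltW et0) Vn; move: hW; lra.
have sgamma : \sum_(a <- A) gamma a <= b2 * (5 * et * n) + et * n.
  apply: (@le_trans _ _ (\sum_(a <- A) (beta (pi a) + et))).
    by rewrite big_seq [leRHS]big_seq; apply: ler_sum => a; exact: gammaP.
  rewrite big_split /= big_const_seq count_predT iter_addr_0 -[X in _ + X]mulr_natr.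
  rewrite lerD2r; apply: le_trans (sum_over_fibers piV piB beta0) _.
  by rewrite ler_wpM2l.
have hC : ent mu setT C <= (2 * c + 1) * (2 / #|` wball r|%:R) * n.
  apply: le_trans (ent_pair_le mu measurableT dZ db) _.
  apply: (@le_trans _ _ ((2 * c + 1) * #|` V|%:R)).
    rewrite mulrDl mul1r; apply: lerD.
      by apply: le_trans Zc _; rewrite [2 * c]mulrC -mulrA ler_wpM2l.
    apply: le_trans (ent_le_card mu measurableT db) _.
    rewrite prT mul1r card_ffun card_bool -cardfE natrX lnXn // -[leLHS]mulr_natr.
    rewrite ler_piMl // (_ : 2 = 1 + 1 :> R) //; apply: le_ln1Dx; lra.
  rewrite -mulrA ler_wpM2l ?addr_ge0 ?mulr_ge0 //.
  by rewrite mulrAC ler_pdivlMr // (lt_le_trans _ b1).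
have E1 : 0 < #|` E|%:R :> R by rewrite ltr0n cardfs_gt0.
rewrite /mean_ent -/n ler_pdivrMr // -(ler_pM2l E1).
apply: le_trans main _.
set hQ := ent mu setT (joint Q E).
have h1 : #|` E|%:R * ((hQ / #|` E|%:R + e + (2 * c + 1) * (2 / #|` wball r|%:R)) * n) =
   #|` E|%:R * ((2 * c + 1) * (2 / #|` wball r|%:R) * n) + n * hQ + #|` E|%:R * (e * n).
  by field; rewrite !gt_eqF // (lt_le_trans _ b1).
rewrite h1; apply: lerD; first by rewrite lerD2r ler_wpM2l // ltW.
rewrite -mulrA ler_wpM2l ?(ltW E1) //.
apply: (@le_trans _ _ (ln #|J'|%:R * (et * (6 + 5 * b2)) * n)); last by rewrite ler_wpM2r // ltW.
rewrite -mulrA ler_wpM2l //; apply: le_trans (lerD sbeta sgamma) _.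
by rewrite le_eqVlt; apply/orP; left; apply/eqP; ring.
Qed.

End Choice.
Hypothesis vaG : virtually_abelian G.
Hypothesis vaH : virtually_abelian H.
Hypothesis shannon : shannon_cocycle mu kappa.

(** For infinite [G] the cost [c] of [cocycle_sublinear] is [o(r)], while the ball
    of radius [r] has more than [r] elements, so the last term of
    [main_estimate_radius] is small for large [r]. *)
Theorem main_estimate (J : finType) (f : X -> J) (e : R) : dmeas f -> 0 < e ->
  exists (J' : finType) (Rl : X -> J'), dmeas Rl /\
  forall (E : {fset H}) (Q : H -> X -> J'), E != fset0 ->
  (forall h, dmeas (Q h)) ->
  (forall h, ent mu setT (Q h) = ent mu setT Rl) ->
  (forall x g, X1 x -> Q (kappa g x) x = Rl (act g x)) ->
  exists2 A : {fset G}, A != fset0 &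
    mean_ent mu act f A <= ent mu setT (joint Q E) / #|` E|%:R + e.
Proof.
move=> df e0; have dl := dmeas_orbit_label pmp df.
have [[F allF]|infG] := pselect (exists F : {fset G}, forall g, g \in F).
  exists {ffun F -> J}, (joint (orbit_label act f) F); split; first exact: dmeas_joint.
  move=> E Q E0 dQ lawQ _; have F1 : F != fset0 by apply/fset0Pn; exists 1%g.
  exists F => //; apply: ler_wpDr; first exact: ltW.
  have /fset0Pn[h hE] := E0.
  have [x0 Xx] : X1 !=set0.
    apply/set0P/eqP => X10; have := conullX1; rewrite X10 measure0 => /eqP.
    by rewrite eq_sym onee_eq0.
  have cardE : (#|` E| <= #|` F|)%N.
    have sub : (E `<=` [fset kappa g x0 | g in F])%fset.
      apply/fsubsetP => k _; have [g <-] := kappa_surj k Xx.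
      by apply/imfsetP; exists g => //=; exact: allF.
    by apply: leq_trans (fsubset_leq_card sub) _; exact: leq_imfset_card.
  rewrite /mean_ent -(lawQ h); apply: ler_pM.
  - by apply: ent_ge0.
  - by rewrite invr_ge0.
  - apply: ent_le => //; first exact: dmeas_joint.
    by move=> x y _ _ /joint_eqP; exact.
  - by rewrite lef_pV2 ?posrE ?ltr0n ?cardfs_gt0 // ler_nat.
(* As [c <= 4 (e / 64) (r + 1)], the error term is at most [e / 4 + 2 / (r + 1)], and
   the second summand is at most [e / 4] once [r + 1 >= 8 / e]. *)
have e1 : 0 < e / 64 by rewrite divr_gt0.
have [N HN] := cocycle_sublinear pmp mX1 conullX1 dkappa kappaM gens vaH shannon e1.
have [N' HN'] := exists_nat_ge (8 / e).
pose r := (N + N')%N; pose c := e / 64 * (r + r + 1 + (r + r))%:R.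
have c0 : 0 <= c by rewrite mulr_ge0 // ltW.
have kd u : u \in wball (r + r + 1 + (r + r)) -> describable mu c (kappa u).
  by apply: HN; rewrite /r -!addnA leq_addr.
exists {ffun wball (r + r) -> J}, (joint (orbit_label act f) (wball (r + r))).
split; first exact: dmeas_joint.
move=> E Q E0 dQ _ QR; have e2 : 0 < e / 2 by rewrite divr_gt0.
have [A A0 hA] := main_estimate_radius vaG df c0 kd E0 e2 dQ QR.
exists A => //; apply: le_trans hA _; rewrite -addrA lerD2l.
have r1 : 0 < r.+1%:R :> R by [].
suff : (2 * c + 1) * (2 / #|` wball r|%:R) <= e / 2 by lra.
apply: (@le_trans _ _ ((2 * c + 1) * (2 / r.+1%:R))).
  have c1 : 0 <= 2 * c + 1 by lra.
  have br : (r < #|` wball r|)%N by exact: card_wball_lt gensP infG r.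
  apply: (ler_wpM2l c1); apply: ler_wpM2l => //.
  by rewrite lef_pV2 ?posrE ?ler_nat // ltr0n; apply: leq_ltn_trans br.
rewrite mulrA ler_pdivrMr //.
have h1 : 8 <= e * r.+1%:R.
  rewrite mulrC -ler_pdivrMr //; apply: le_trans HN' _.
  by rewrite ler_nat /r ltnW // ltnS leq_addl.
have h2 : (r + r + 1 + (r + r))%:R <= 4 * r.+1%:R :> R.
  by rewrite -natrM ler_nat; lia.
have := ler_wpM2l (ltW e1) h2; rewrite -/c; lra.
Qed.

End MainEstimate.

(** * Passage along the orbit equivalence *)

Section Negligible.
Context (R : realType) d (X : measurableType d).
Variable mu : probability X R.

Lemma negligible_countable_bigcup (I : Type) (N : I -> set X) :
  countable [set: I] -> (forall i, mu.-negligible (N i)) ->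
  mu.-negligible (\bigcup_i N i).
Proof.
move=> /countable_injP[k kinj] N0.
have -> : \bigcup_i N i = \bigcup_n \bigcup_(i in [set i | k i = n]) N i.
  rewrite eqEsubset; split=> [x [i _ Ni]|x [n _ [i _ Ni]]]; last by exists i.
  by exists (k i) => //; exists i.
apply: negligible_bigcup => n.
have [E|/set0P[i /= ki]] := eqVneq [set i | k i = n] set0.
  by rewrite E bigcup_set0; exact: negligible_set0.
apply: negligibleS (N0 i) => x [j /= kj Nj].
by rewrite (kinj i j) ?inE // ki kj.
Qed.

Lemma negligible_setC_conull (A : set X) : measurable A -> mu A = 1%E ->
  mu.-negligible (~` A).
Proof.
move=> mA A1; have A0 : mu (~` A) = 0%E by rewrite (prE mu (measurableC mA)) pr_conullC.
by apply/negligibleP; first exact: measurableC.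
Qed.

Lemma negligible_conull (A : set X) : measurable A -> mu.-negligible (~` A) ->
  mu A = 1%E.
Proof.
move=> mA /(measure_negligible (measurableC mA)) A0.
have := prC mu mA; rewrite {1}/pr A0 /= => /esym/eqP; rewrite subr_eq0 => /eqP h.
by rewrite (prE mu mA) -h.
Qed.

End Negligible.

Section EntropyTransport.
Context (R : realType) d d' (X : measurableType d) (Y : measurableType d').
Variables (mu : probability X R) (nu : probability Y R).

Lemma ent_factor (X0 : set X) (Y0 : set Y) (phi : X -> Y) (T : finType)
    (g : Y -> T) (q : X -> T) :
  measurable X0 -> mu X0 = 1%E -> measurable Y0 -> nu Y0 = 1%E ->
  (forall B, measurable B -> mu (X0 `&` phi @^-1` B) = nu (Y0 `&` B)) ->
  dmeas g -> dmeas q -> (forall x, X0 x -> q x = g (phi x)) ->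
  ent mu setT q = ent nu setT g.
Proof.
move=> mX0 X01 mY0 Y01 pres dg dq qg.
rewrite (ent_conull mX0 X01 dq) (ent_conull mY0 Y01 dg) /ent /pr X01 Y01.
congr (_ - _); apply: eq_bigr => t _; congr eta; rewrite /law /pr -pres; last exact: dg.2.
by congr (fine (mu _)); rewrite eqEsubset; split=> x [Xx /= <-]; split=> //=; rewrite qg.
Qed.

Variables (G : groupType) (act : G -> X -> X).
Hypothesis pmp : pmp_action mu act.

Lemma inf_ent_le_action_entropy (J : finType) (f : X -> J) :
  (exists F : nat -> {fset G}, folner_sequence R F) -> dmeas f ->
  ((inf_ent mu act f)%:E <= action_entropy mu act)%E.
Proof.
move=> folner df; pose f' x : 'I_#|J| := enum_rank (f x).
have df' : dmeas f' by exact: dmeas_comp.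
have -> : inf_ent mu act f = inf_ent mu act f'.
  congr inf; apply: eq_imagel => F _; rewrite /mean_ent; congr (_ / _).
  have dl := dmeas_orbit_label pmp df; have dl' := dmeas_orbit_label pmp df'.
  apply: ent_eq => //; try exact: dmeas_joint.
    move=> x y _ _ /joint_eqP e; apply/joint_eqP => a aF.
    by apply: enum_rank_inj; exact: e.
  move=> x y _ _ /joint_eqP e; apply/joint_eqP => a aF.
  by have := e a aF; rewrite /orbit_label /f' => ->.
apply: ereal_sup_ubound; exists #|J|, (fun i => f' @^-1` [set i]); split.
  split=> [i||]; first exact: df'.2.
    by move=> i j _ _ [x [/= <- <-]].
  by rewrite -subTset => x _; exists (f' x).
by rewrite (entropy_partitionE pmp folner df').
Qed.

End EntropyTransport.

Lemma dmeas_patch d (X : measurableType d) (T : finType) (A : set X) (f : X -> T) (c : T) :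
  measurable A -> (forall t, measurable (A `&` f @^-1` [set t])) ->
  dmeas (fun x => if `[< A x >] then f x else c).
Proof.
move=> mA mf; apply: dmeas_fin => t.
have -> : (fun x => if `[< A x >] then f x else c) @^-1` [set t] =
    (A `&` f @^-1` [set t]) `|` (~` A `&` [set _ | c = t]).
  rewrite eqEsubset; split=> x /=.
    by case: asboolP => Ax e; [left|right].
  by case=> -[Ax e]; case: asboolP.
apply: measurableU => //; apply: measurableI; first exact: measurableC.
have [->|/eqP ct] := eqVneq c t.
  by rewrite (_ : [set _ | _] = setT) // -subTset.
by rewrite (_ : [set _ | _] = set0) // -subset0.
Qed.

Section Symmetry.
Context (R : realType) d d' (X : measurableType d) (Y : measurableType d').
Variables (mu : probability X R) (nu : probability Y R).
Variables (G H : groupType) (alpha : G -> X -> X) (beta : H -> Y -> Y).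

Lemma orbit_equivalence_sym (X0 : set X) (Y0 : set Y) (phi : X -> Y) (psi : Y -> X) :
  orbit_equivalence mu nu alpha beta X0 Y0 phi psi ->
  orbit_equivalence nu mu beta alpha Y0 X0 psi phi.
Proof.
case=> mX0 X01 invX0 mY0 Y01 invY0 bij can mphi mpsi pres orb.
have phiY x : X0 x -> Y0 (phi x) by case: bij => h _ _; exact: h.
have canx x : X0 x -> psi (phi x) = x by move=> Xx; apply: can; rewrite inE.
have surj y : Y0 y -> exists2 x, X0 x & phi x = y.
  by case: bij => _ _ h Yy; have [x Xx <-] := h y Yy; exists x.
have psiX y : Y0 y -> X0 (psi y) by move=> /surj[x Xx <-]; rewrite canx.
have cany y : Y0 y -> phi (psi y) = y by move=> /surj[x Xx <-]; rewrite canx.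
split=> //.
- split.
  + by move=> y; exact: psiX.
  + move=> y z; rewrite !inE => Yy Yz e.
    by rewrite -(cany y) // e cany.
  + by move=> x Xx; exists (phi x); [exact: phiY|exact: canx].
- by move=> y; rewrite inE; exact: cany.
- move=> B mB; have mP : measurable (Y0 `&` psi @^-1` B) by exact: mpsi.
  have := pres _ mP.
  rewrite (_ : X0 `&` phi @^-1` _ = X0 `&` B); last first.
    rewrite eqEsubset; split=> x [Xx /=] => [[_]|Bx]; first by rewrite canx.
    by split=> //; split; [exact: phiY|rewrite /= canx].
  by rewrite setIA setIid => ->.
- move=> y Yy; have Xx := psiX y Yy; have := orb _ Xx; rewrite cany // => e.
  rewrite -e eqEsubset; split=> z.
    move=> [_ [_ [g _ <-] <-] <-]; rewrite canx; first by exists g.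
    exact: invX0.
  move=> [g _ <-]; exists (phi (alpha g (psi y))); last by rewrite canx //; exact: invX0.
  by exists (alpha g (psi y)) => //; exists g.
Qed.

End Symmetry.

Section Half.
Context (R : realType) d d' (X : measurableType d) (Y : measurableType d').
Variables (mu : probability X R) (nu : probability Y R).
Variables (G H : groupType) (alpha : G -> X -> X) (beta : H -> Y -> Y).
Hypothesis fgG : finitely_generated G.
Hypothesis vaG : virtually_abelian G.
Hypothesis fgH : finitely_generated H.
Hypothesis vaH : virtually_abelian H.
Hypothesis pmp_alpha : pmp_action mu alpha.
Hypothesis free_alpha : free_action mu alpha.
Hypothesis pmp_beta : pmp_action nu beta.
Hypothesis free_beta : free_action nu beta.
Variables (X0 : set X) (Y0 : set Y) (phi : X -> Y) (psi : Y -> X).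
Hypothesis oe : orbit_equivalence mu nu alpha beta X0 Y0 phi psi.
Variable kappa : G -> X -> H.
Hypothesis cocycle : is_cocycle mu alpha beta phi kappa.
Hypothesis shannon : shannon_cocycle mu kappa.

Let countG : countable [set: G].
Proof. by have [gens gensP] := fgG; exact: fg_countable gensP. Qed.

Let countH : countable [set: H].
Proof. by have [gens gensP] := fgH; exact: fg_countable gensP. Qed.

Lemma dmeas_cocycle g : dmeas (kappa g).
Proof.
split; last by move=> s; exact: cocycle.1.
by apply: (@sub_countable _ _ _ [set: H]) => //; exact: subset_card_le.
Qed.

Definition good_point (x : X) : Prop :=
  [/\ X0 x, forall g, alpha g x = x -> g = 1%g,
      forall s, beta s (phi x) = phi x -> s = 1%g &
      forall g, beta (kappa g x) (phi x) = phi (alpha g x)].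

(** The groups are countable, so the null sets on which one of the identities fails
    can be collected, and the union of their translates is still null. *)
Lemma exists_good_set : exists X1 : set X,
  [/\ measurable X1, mu X1 = 1%E, forall g x, X1 x -> X1 (alpha g x) &
      X1 `<=` good_point].
Proof.
have good_ae : mu.-negligible (~` good_point).
  have n1 := negligible_setC_conull (oe_dom_measurable oe) (oe_dom_conull oe).
  have n3 : mu.-negligible (X0 `&` ~` [set x | forall s, beta s (phi x) = phi x -> s = 1%g]).
    have [N [mN N0 sN]] := free_beta.
    exists (X0 `&` phi @^-1` N); split.
    - exact: (oe_measurable oe (oe_dom_measurable oe)).
    - rewrite (oe_preserving oe) //; apply/eqP; rewrite eq_le measure_ge0 andbT -N0.
      by apply: le_measure; rewrite ?inE //; apply: measurableI => //; exact: oe_cod_measurable oe.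
    - by move=> x [Xx nx]; split=> //=; apply: sN => /= h; apply: nx.
  have n4 := negligible_countable_bigcup countG (fun g => cocycle.2 g).
  apply: negligibleS (negligibleU (negligibleU n1 free_alpha) (negligibleU n3 n4)).
  move=> x nx; apply: contrapT => h; apply: nx.
  have Xx : X0 x by apply: contrapT => ?; apply: h; left; left.
  split=> //.
  - by apply: contrapT => ?; apply: h; left; right.
  - by apply: contrapT => ?; apply: h; right; left.
  - by move=> g; apply: contrapT => ?; apply: h; right; right; exists g.
have [N [mN N0 sN]] := good_ae.
pose U := \bigcup_g (alpha g @^-1` N).
have mpre g : measurable (alpha g @^-1` N).
  by rewrite -[X in measurable X]setTI; exact: (pmp_measurable pmp_alpha).
have mU : measurable U by apply: countable_bigcup_measurable_in.
exists (~` U); split.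
- exact: measurableC.
- apply: negligible_conull; first exact: measurableC.
  rewrite setCK; apply: negligible_countable_bigcup => // g.
  have pre0 : mu (alpha g @^-1` N) = 0%E by rewrite (pmp_preserving pmp_alpha).
  exact/negligibleP.
- move=> g x nU [h _ /=]; rewrite -(pmp_actM pmp_alpha) => hN; apply: nU.
  by exists (h * g)%g.
- move=> x nU; apply: contrapT => ng; apply: nU; exists 1%g => //=.
  by rewrite (pmp_act1 pmp_alpha); exact: sN.
Qed.

(** The partition from [main_estimate] is carried to [Y] by [psi]; off [Y0] it is
    continued by a constant. *)
Theorem entropy_le : (action_entropy mu alpha <= action_entropy nu beta)%E.
Proof.
have [gens gensP] := fgG; have [gensH gensHP] := fgH.
have folG := folner_exists R gensP vaG; have folH := folner_exists R gensHP vaH.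
have [X1 [mX1 X11 invX1 goodX1]] := exists_good_set.
have freeb x a b : X1 x -> beta a (phi x) = beta b (phi x) -> a = b.
  move=> /goodX1[_ _ fb _] e.
  have /fb ba1 : beta (b^-1 * a)%g (phi x) = phi x.
    by rewrite (pmp_actM pmp_beta) e -(pmp_actM pmp_beta) mulVg (pmp_act1 pmp_beta).
  by rewrite -(mulVKg b a) ba1 mulg1.
have kappaM g h x : X1 x -> kappa (g * h)%g x = (kappa g (alpha h x) * kappa h x)%g.
  move=> Xx; apply: (freeb x) => //; have [_ _ _ kx] := goodX1 _ Xx.
  have [_ _ _ khx] := goodX1 _ (invX1 h _ Xx).
  by rewrite kx (pmp_actM pmp_beta) kx khx (pmp_actM pmp_alpha).
have X10 x : X1 x -> X0 x by move=> /goodX1[].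
have canx x : X0 x -> psi (phi x) = x by move=> Xx; apply: (oe_inverse oe); rewrite inE.
have kappa_inj x g h : X1 x -> kappa g x = kappa h x -> g = h.
  move=> Xx e; have [_ fa _ kx] := goodX1 _ Xx.
  have : alpha g x = alpha h x.
    rewrite -(canx (alpha g x)); last exact/X10/invX1.
    by rewrite -kx e kx canx //; exact/X10/invX1.
  move=> /(congr1 (alpha h^-1)); rewrite -!(pmp_actM pmp_alpha) mulVg (pmp_act1 pmp_alpha).
  by move=> /fa/(congr1 (fun z => (h * z)%g)); rewrite mulVKg mulg1.
have kappa_surj x s : X1 x -> exists g, kappa g x = s.
  move=> Xx; have [_ _ _ kx] := goodX1 _ Xx.
  have : act_orbit beta (phi x) (beta s (phi x)) by exists s.
  rewrite -(oe_orbits oe (X10 _ Xx)) => -[_ [g _ <-] e]; exists g.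
  by apply: (freeb x) => //; rewrite kx.
apply: ge_ereal_sup => _ [k [P [[mP trivP coverP] ->]]].
have labP x : exists i, P i x.
  by have : [set: X] x by []; rewrite -coverP => -[i _ Pi]; exists i.
pose f x : 'I_k := sval (cid (labP x)).
have fP x : P (f x) x by rewrite /f; case: cid.
have PE i : P i = f @^-1` [set i].
  rewrite eqEsubset; split=> x /=; last by move=> <-; exact: fP.
  by move=> Pi; apply: (trivP (f x) i) => //; exists x; split.
have df : dmeas f by apply: dmeas_fin => i; rewrite -PE.
rewrite (entropy_partitionE pmp_alpha folG df PE).
apply/lee_addgt0Pr => e e0; have e2 : 0 < e / 2 by rewrite divr_gt0.
have [J' [Rl [dRl main]]] := main_estimate pmp_alpha mX1 X11 invX1 dmeas_cocycle
  kappaM kappa_inj kappa_surj gensP vaG vaH shannon df e2.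
have [x0] := prob_inhabited mu.
pose RY y := if `[< Y0 y >] then Rl (psi y) else Rl x0.
have mY0 := oe_cod_measurable oe; have mX0 := oe_dom_measurable oe.
have dRY : dmeas RY.
  apply: (@dmeas_patch _ _ _ Y0 (Rl \o psi) (Rl x0)) => // j.
  rewrite comp_preimage; have mj := dRl.2 j.
  have h := oe_inverse_measurable oe mY0 mj. exact: h.
pose Q h x := if `[< X0 x >] then RY (beta h (phi x)) else Rl x0.
have dl := dmeas_orbit_label pmp_beta dRY.
have dQ h : dmeas (Q h).
  apply: dmeas_patch => // j.
  have h1 := oe_measurable oe mX0 ((dl h).2 j); exact: h1.
have QE h x : X0 x -> Q h x = orbit_label beta RY h (phi x).
  by move=> Xx; rewrite /Q; case: asboolP.
have RYphi x : X0 x -> RY (phi x) = Rl x.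
  move=> Xx; rewrite /RY; case: asboolP => [_|[]]; first by rewrite canx.
  by have [+ _ _] := oe_bij oe; apply.
have fac (T : finType) (g : Y -> T) (q : X -> T) :
  dmeas g -> dmeas q -> (forall x, X0 x -> q x = g (phi x)) -> ent mu setT q = ent nu setT g.
  exact: (ent_factor mX0 (oe_dom_conull oe) mY0 (oe_cod_conull oe) (oe_preserving oe)).
have QR x g : X1 x -> Q (kappa g x) x = Rl (alpha g x).
  move=> Xx; have [_ _ _ kx] := goodX1 _ Xx.
  rewrite QE; last exact: X10.
  by rewrite /orbit_label kx RYphi //; exact/X10/invX1.
have lawQ h : ent mu setT (Q h) = ent mu setT Rl.
  rewrite (fac _ _ _ (dl h) (dQ h) (QE h)) (ent_transform (pmp_preserving pmp_beta h) dRY).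
  by rewrite (fac _ _ _ dRY dRl) // => x Xx; rewrite RYphi.
have [E E0 hE] := inf_ent_adherent pmp_beta dRY e2.
have [A A0 hA] := main E Q E0 dQ lawQ QR.
apply: (@le_trans _ _ ((inf_ent nu beta RY)%:E + e%:E)%E); last first.
  by apply: leeD => //; exact: inf_ent_le_action_entropy.
rewrite -EFinD lee_fin.
have h1 := inf_ent_le pmp_alpha df A0.
have h2 : ent mu setT (joint Q E) = ent nu setT (joint (orbit_label beta RY) E).
  apply: fac; [exact: dmeas_joint|exact: dmeas_joint|].
  by move=> x Xx; apply/ffunP => h; rewrite !ffunE QE.
move: hE hA h1; rewrite /mean_ent h2; lra.
Qed.

End Half.

Theorem theorem1 (R : realType) (d d' : measure_display)
    (X : measurableType d) (Y : measurableType d')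
    (mu : probability X R) (nu : probability Y R)
    (G H : groupType) (alpha : G -> X -> X) (beta : H -> Y -> Y)
    (stdX : standard_borel R X) (stdY : standard_borel R Y)
    (fgG : finitely_generated G) (vaG : virtually_abelian G)
    (fgH : finitely_generated H) (vaH : virtually_abelian H)
    (pmp_alpha : pmp_action mu alpha) (free_alpha : free_action mu alpha)
    (pmp_beta : pmp_action nu beta) (free_beta : free_action nu beta)
    (soe : shannon_orbit_equivalent mu nu alpha beta) :
  action_entropy mu alpha = action_entropy nu beta.
Proof.
have [X0 [Y0 [phi [psi [oe [kappa [lambda [ck cl sk sl]]]]]]]] := soe.
apply/eqP; rewrite eq_le; apply/andP; split.
  exact: (entropy_le fgG vaG fgH vaH pmp_alpha free_alpha pmp_beta free_beta oe ck sk).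
exact: (entropy_le fgH vaH fgG vaG pmp_beta free_beta pmp_alpha free_alpha
  (orbit_equivalence_sym oe) cl sl).
Qed.
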